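(* Let $p_n(t)$ be the conditional sojourn time density in the $M/M/1$ processor sharing queue with balking $b_n=1/(n+1)$ (service rate $1$, arrival rate $\rho$). As $\rho\to\infty$ the following asymptotic expansions hold. (1) Let $t=T\rho$ and $n=N\rho$ with $T,N>0$ fixed. Then $$p_n(t)=\rho^{-1}P_0(N,T)+\rho^{-2}P_1(N,T)+O(\rho^{-3}),$$ where $$P_0(N,T)=\frac{e^{U-T}}{N-U}=\frac{N-U-1}{(N-1)(N-U)}$$ and $U=U(N,T)$ is defined implicitly by $$\frac{U}{N-1}=1-e^{U-T}$$ (the solution with $U<N$, i.e. the branch with $U(N,0)=0$). If $N=1$ then $U=0$ and $P_0(1,T)=e^{-T}$. The correction term $P_1$ is, with $\xi=N-U$ and $\eta=U$, $$P_1(N,T)=-\frac{(\xi-1)(2\xi-3)}{2\xi^5}+\frac{3(\xi-1)(2\xi^2-2\xi-3)}{2\xi^5(\xi+\eta-1)}-\frac{(\xi-1)^2(2\xi^3+2\xi^2-5\xi-15)}{2\xi^5(\xi+\eta-1)^2}-\frac{(\xi-1)^3(2\xi^2+4\xi+3)}{2\xi^5(\xi+\eta-1)^3}-\frac{2(\xi-1)(2\xi-3)}{\xi^5(\xi+\eta-1)}\log\left|\frac{\xi+\eta-1}{\xi-1}\right|$$ (for $N=1$ understood as the limit $N\to1$, namely $P_1(1,T)=(2T-\tfrac92)e^{-T}+8e^{-2T}-\tfrac92e^{-3T}$). (2) Let $t=\tau/\rho$ with $\tau>0$ fixed and let $n$ be fixed ($n=O(1)$). Then $$p_n(t)\sim\int_0^1(1-\xi)^n\,J_0\Big(2\sqrt{\tau}\sqrt{-\xi-\log(1-\xi)}\,\Big)\,d\xi,$$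 where $J_0$ is the Bessel function of the first kind of order $0$.
   Context: $\mathcal{V}_n$ denotes the sojourn time of a tagged customer who enters the PS queue and finds $n$ other customers present, and $\mathbf{V}_n(t)=\mathrm{Prob}[\mathcal{V}_n>t]$. With $b_n=1/(n+1)$, the functions $\mathbf{V}_n$ ($n\ge 0$, $t\ge 0$, $0\le \mathbf V_n\le 1$) are the bounded solution of $$\mathbf{V}'_n(t)=\frac{n}{n+1}\mathbf{V}_{n-1}(t)-\Big(1+\frac{\rho}{n+1}\Big)\mathbf{V}_n(t)+\frac{\rho}{n+1}\mathbf{V}_{n+1}(t),\qquad \mathbf{V}_n(0)=1.$$ The conditional sojourn time density is $p_n(t)=-\mathbf{V}_n'(t)$; equivalently $$p'_n(t)=\frac{n}{n+1}p_{n-1}(t)-\Big(1+\frac{\rho}{n+1}\Big)p_n(t)+\frac{\rho}{n+1}p_{n+1}(t),\quad t>0,\qquad p_n(0)=\frac{1}{n+1},\quad n\ge 0$$ (the term with $p_{n-1}$ is absent for $n=0$). The notation $f\sim g$ means $f/g\to1$ in the stated limit; in part (1) the limit is taken along values of $\rho$ for which $n=N\rho$ is an integer. *)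

(* Defs.v *)
From Stdlib Require Import Reals Factorial ClassicalEpsilon.
From Coquelicot Require Import Coquelicot.
Open Scope R_scope.

(** [V n t] is the probability that a tagged customer who finds [n] other
    customers present has sojourn time larger than [t].  The backward equations
    are imposed on [t > 0] together with right-continuity at [0], since
    Coquelicot's derivative is two-sided.  For [n = 0] the term
    [V (Nat.pred 0) t] is multiplied by [0]. *)
Record is_sojourn_tail (rho : R) (V : nat -> R -> R) : Prop := {
  tail_bounded : forall n t, 0 <= t -> 0 <= V n t <= 1;
  tail_init : forall n, V n 0 = 1;
  tail_right_continuous : forall n,
    filterlim (V n) (at_right 0) (locally (V n 0));
  tail_ode : forall n t, 0 < t ->
    is_derive (V n) t
      (INR n / (INR n + 1) * V (Nat.pred n) t
       - (1 + rho / (INR n + 1)) * V n t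
       + rho / (INR n + 1) * V (S n) t) }.

Definition sojourn_density (V : nat -> R -> R) (n : nat) (t : R) : R :=
  - Derive (V n) t.

Definition is_U (N T u : R) : Prop :=
  u < N /\
  (N <> 1 -> u / (N - 1) = 1 - exp (u - T)) /\
  (N = 1 -> u = 0).

Definition U (N T : R) : R := epsilon (inhabits 0) (is_U N T).

Definition P0 (N T : R) : R := exp (U N T - T) / (N - U N T).

Definition P1_formula (xi eta : R) : R :=
  - ((xi - 1) * (2 * xi - 3)) / (2 * xi ^ 5)
  + 3 * (xi - 1) * (2 * xi ^ 2 - 2 * xi - 3)
    / (2 * xi ^ 5 * (xi + eta - 1))
  - (xi - 1) ^ 2 * (2 * xi ^ 3 + 2 * xi ^ 2 - 5 * xi - 15)
    / (2 * xi ^ 5 * (xi + eta - 1) ^ 2)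
  - (xi - 1) ^ 3 * (2 * xi ^ 2 + 4 * xi + 3)
    / (2 * xi ^ 5 * (xi + eta - 1) ^ 3)
  - 2 * (xi - 1) * (2 * xi - 3) / (xi ^ 5 * (xi + eta - 1))
    * ln (Rabs ((xi + eta - 1) / (xi - 1))).

Definition P1_generic (N T : R) : R := P1_formula (N - U N T) (U N T).

(** At [N = 1] the formula is singular and [P1] is its limit as [N -> 1]. *)
Definition P1 (N T : R) : R :=
  if Req_EM_T N 1 then real (Lim (fun M => P1_generic M T) 1)
  else P1_generic N T.

Definition J0 (x : R) : R :=
  Series (fun k => (-1) ^ k / INR (fact k) ^ 2 * (x / 2) ^ (2 * k)).

(** The value at the endpoint [xi = 1], where [ln 0] is a dummy value, does not
    affect the integral of this function over [0, 1]. *)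
Definition integrand (n : nat) (tau xi : R) : R :=
  (1 - xi) ^ n * J0 (2 * sqrt tau * sqrt (- xi - ln (1 - xi))).

(* Main.v *)
Require Import Defs.
From Stdlib Require Import Reals Lra Lia Psatz Factorial ClassicalEpsilon.
From Coquelicot Require Import Coquelicot.
Open Scope R_scope.

(** Both expansions are stability estimates.  A function that nearly solves the
    backward equations, with nearly the right initial values, is close to the density,
    because the rates are non-negative and the row sums non-positive: this is the
    comparison principle [comparison], used in the form [domination].

    On the scale [t = T * rho], [n = N * rho], the two-term expansion is the
    approximate solution.  The change of variables from [(N, T)] to the starting point
    [xi = N - U] and the parameter [s = T - U] of the characteristic through [(N, T)]
    turns [P0] and [P1] into polynomials in [s], [exp (- s)] and [1 / xi]
    ([P0_eval], [P1_eval]).  This removes the apparent singularity of [P1] at [N = 1],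
    makes all derivatives bounded as long as [N] stays away from [0], and reduces the
    two transport equations ([transport_P0], [transport_P1]) to rational identities.
    The residual of the expansion is then of order [rho ^ (-4)]
    ([approx_residual]), its initial error of order [rho ^ (-3)], and over a time of order
    [rho] the total error is of order [rho ^ (-3)].  Near [N = 0] the expansion is
    singular; but from [n = N * rho] the queue reaches such lengths only with an
    exponentially small probability, which a barrier function expresses
    ([barrier_generator], [density_expansion]).

    On the scale [t = tau / rho] with [n] fixed, arrivals dominate and the density
    follows, up to [O(/ rho)], the pure birth equations
    [q_n' = (q_(n+1) - q_n) / (n + 1)].  The integral of the theorem solves them: with
    [phi = - xi - ln (1 - xi)] and the Bessel function written as an entire function
    [bessel] of [tau * phi], integration by parts in [xi] is exactly Bessel's equation
    ([kernel_parts], [truncated_derive]).  Energy estimates for [bessel] give the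
    boundedness used in the comparison and the decay which makes the integrand Riemann
    integrable up to [xi = 1].  The integral is positive because it is a limit of
    densities with a common positive lower bound ([integral_pos]), so the convergence
    of the difference to [0] is also that of the quotient to [1]. *)

(** * Functions on the half-line, right-continuous at the origin *)

Ltac as_reals := match goal with |- ?a = ?b => change (@eq R a b) end.

(** Solutions live on the closed half-line while derivatives are two-sided, so
    that at the origin only a one-sided limit is available. *)
Definition right_continuous0 (f : R -> R) : Prop :=
  filterlim f (at_right 0) (locally (f 0)).

Lemma continuous_right_continuous0 f : continuous f 0 -> right_continuous0 f.
Proof.
  intros H. unfold right_continuous0.
  apply filterlim_filter_le_1 with (2 := H). apply filter_le_within.
Qed.

Lemma right_continuous0_plus f g :
  right_continuous0 f -> right_continuous0 g ->
  right_continuous0 (fun t => f t + g t).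
Proof. intros Hf Hg. eapply filterlim_comp_2; [exact Hf | exact Hg | apply (filterlim_plus (f 0) (g 0))]. Qed.

Lemma right_continuous0_mult f g :
  right_continuous0 f -> right_continuous0 g ->
  right_continuous0 (fun t => f t * g t).
Proof. intros Hf Hg. eapply filterlim_comp_2; [exact Hf | exact Hg | apply (filterlim_mult (f 0) (g 0))]. Qed.

Lemma right_continuous0_ext f g :
  (forall t, 0 <= t -> f t = g t) -> right_continuous0 f -> right_continuous0 g.
Proof.
  intros E Hf. unfold right_continuous0. rewrite <- (E 0) by lra.
  apply filterlim_ext_loc with (2 := Hf). exists posreal_one.
  intros t _ Ht. apply E. lra.
Qed.

Lemma right_continuous0_const (c : R) : right_continuous0 (fun _ => c).
Proof. apply continuous_right_continuous0, continuous_const. Qed.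

Lemma right_continuous0_scal c f :
  right_continuous0 f -> right_continuous0 (fun t => c * f t).
Proof. intros Hf. apply (right_continuous0_mult (fun _ => c) f); auto using right_continuous0_const. Qed.

Lemma right_continuous0_minus f g :
  right_continuous0 f -> right_continuous0 g ->
  right_continuous0 (fun t => f t - g t).
Proof.
  intros Hf Hg. apply right_continuous0_ext with (fun t => f t + (-1) * g t).
  - intros; ring.
  - apply right_continuous0_plus; auto using right_continuous0_scal.
Qed.

Lemma derive_nonneg_incr (h h' : R -> R) (a b : R) :
  a <= b ->
  (forall u, a <= u <= b -> is_derive h u (h' u)) ->
  (forall u, a <= u <= b -> 0 <= h' u) -> h a <= h b.
Proof.
  intros Hab Hd Hp.
  destruct (MVT_gen h a b h') as [c [Hc E]].
  - intros x Hx. rewrite Rmin_left, Rmax_right in Hx by lra. apply Hd. lra.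
  - intros x Hx. rewrite Rmin_left, Rmax_right in Hx by lra.
    apply derivable_continuous_pt. exists (h' x).
    apply is_derive_Reals, Hd. lra.
  - rewrite Rmin_left, Rmax_right in Hc by lra.
    specialize (Hp c Hc). nra.
Qed.

Lemma derive_nonneg_incr0 (h h' : R -> R) (t : R) :
  0 <= t -> right_continuous0 h ->
  (forall u, 0 < u <= t -> is_derive h u (h' u)) ->
  (forall u, 0 < u <= t -> 0 <= h' u) -> h 0 <= h t.
Proof.
  intros Ht Hr Hd Hp.
  destruct (Req_dec t 0) as [->|Hne]; [lra|].
  apply (filterlim_le (F := at_right 0) h (fun _ => h t) (h 0) (h t)).
  - assert (Ht' : 0 < t) by lra.
    exists (mkposreal t Ht'). intros s Hs Hs0.
    unfold ball in Hs; simpl in Hs; unfold AbsRing_ball, abs, minus, plus, opp in Hs; simpl in Hs.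
    apply Rabs_def2 in Hs.
    apply derive_nonneg_incr with h'; [lra | |]; intros u Hu; [apply Hd | apply Hp]; lra.
  - exact Hr.
  - apply filterlim_const.
Qed.

(** * A comparison principle for infinite systems of backward equations *)

Definition generator (a b c : nat -> R) (v : nat -> R) (n : nat) : R :=
  a n * v (Nat.pred n) - c n * v n + b n * v (S n).

Record rates (m : nat) (L : R) (a b c : nat -> R) : Prop := {
  rates_down : forall n, (m <= n)%nat -> 0 <= a n;
  rates_up : forall n, (m <= n)%nat -> 0 <= b n;
  rates_total : forall n, (m <= n)%nat -> a n + b n <= c n <= L }.

(** The system is infinite, so there need not be a first time at which positivity
    fails.  Instead, [exp (L * t) * f n t] obeys a differential inequality whose
    coefficients are non-negative and add up to at most [L]; hence a lower bound
    [- g] improves to [- L] times the integral of [g].  Iterating from a constant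
    gives [- M * (L * t) ^ k / fact k], which vanishes as [k] grows.  When [0 < m],
    the index [pred m] carries a prescribed boundary value. *)
Lemma comparison (m : nat) (L Tm K : R) (a b c : nat -> R)
  (f f' : nat -> R -> R) :
  0 <= Tm -> rates m L a b c ->
  (forall n t, (Nat.pred m <= n)%nat -> 0 <= t <= Tm -> - K <= f n t) ->
  (forall t, (0 < m)%nat -> 0 <= t <= Tm -> 0 <= f (Nat.pred m) t) ->
  (forall n, (m <= n)%nat -> 0 <= f n 0) ->
  (forall n, (m <= n)%nat -> right_continuous0 (f n)) ->
  (forall n t, (m <= n)%nat -> 0 < t <= Tm -> is_derive (f n) t (f' n t)) ->
  (forall n t, (m <= n)%nat -> 0 < t <= Tm ->
     generator a b c (fun k => f k t) n <= f' n t) ->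
  forall n t, (Nat.pred m <= n)%nat -> 0 <= t <= Tm -> 0 <= f n t.
Proof.
  intros HTm [Ha Hb Hc] HK Hbd H0 Hrc Hd Hineq.
  assert (HL : 0 <= L).
  { generalize (Ha m (le_n m)) (Hb m (le_n m)) (Hc m (le_n m)); lra. }
  assert (HK0 : - Rmax K 0 <= 0) by (generalize (Rmax_r K 0); lra).
  set (M := Rmax K 0 * exp (L * Tm)).
  assert (HM : 0 <= M).
  { apply Rmult_le_pos; [lra | left; apply exp_pos]. }
  assert (step : forall k n t, (Nat.pred m <= n)%nat -> 0 <= t <= Tm ->
    - (M * ((L * t) ^ k / INR (fact k))) <= exp (L * t) * f n t).
  { induction k as [|k IH]; intros n t Hn Ht.
    - simpl. generalize (HK n t Hn Ht) (exp_pos (L * t)) (Rmax_l K 0); intros.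
      assert (exp (L * t) <= exp (L * Tm)).
      { destruct (Rle_lt_or_eq_dec (L * t) (L * Tm)) as [h|h]; [nra| |].
        - left; now apply exp_increasing.
        - rewrite h; lra. }
      assert (- (Rmax K 0 * exp (L * t)) <= exp (L * t) * f n t) by nra.
      unfold M. nra.
    - assert (Hpos : forall u, 0 <= u -> 0 <= (L * u) ^ S k / INR (fact (S k))).
      { intros u Hu. apply Rdiv_le_0_compat; [apply pow_le; nra|].
        apply INR_fact_lt_0. }
      destruct (Compare_dec.lt_dec n m) as [Hnm|Hnm].
      { replace n with (Nat.pred m) by lia.
        specialize (Hbd t ltac:(lia) Ht). specialize (Hpos t (proj1 Ht)).
        generalize (exp_pos (L * t)). intros. nra. }
      assert (Hmn : (m <= n)%nat) by lia.
      set (g := fun u : R => M * ((L * u) ^ S k / INR (fact (S k)))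
                             + exp (L * u) * f n u).
      assert (Hg : g 0 <= g t).
      { apply derive_nonneg_incr0 with (fun u =>
          M * (L * ((L * u) ^ k / INR (fact k)))
          + (L * exp (L * u) * f n u + exp (L * u) * f' n u)).
        - lra.
        - apply right_continuous0_plus.
          + apply continuous_right_continuous0.
            apply (ex_derive_continuous (V := R_NormedModule)). auto_derive; auto.
          + apply right_continuous0_mult; [|now apply Hrc].
            apply continuous_right_continuous0.
            apply (ex_derive_continuous (V := R_NormedModule)). auto_derive; auto.
        - intros u Hu.
          apply (is_derive_plus (V := R_NormedModule)).
          + assert (Hk := INR_fact_lt_0 k).
            assert (Hsk : INR (fact (S k)) = (INR k + 1) * INR (fact k)).
            { rewrite fact_simpl, mult_INR, S_INR. reflexivity. }
            generalize (pos_INR k). intros Hk0. rewrite Hsk.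
            evar_last.
            { apply is_derive_scal.
              apply (is_derive_ext (fun x => / ((INR k + 1) * INR (fact k)) * (L * x) ^ S k)).
              - intros x. as_reals. unfold Rdiv. ring.
              - apply is_derive_scal. apply is_derive_pow.
                apply (is_derive_scal (fun x => x)). apply is_derive_id. }
            change one with 1. rewrite S_INR. simpl Nat.pred.
            as_reals. field. lra.
          + evar_last.
            { apply (is_derive_mult (fun x => exp (L * x)) (f n) u (L * exp (L * u))).
              - auto_derive; [auto | ring].
              - apply Hd; [exact Hmn | lra].
              - intros; apply Rmult_comm. }
            unfold plus, mult; simpl. ring.
        - intros u Hu.
          specialize (Hineq n u Hmn ltac:(lra)). unfold generator in Hineq.
          assert (Hu' : 0 <= u <= Tm) by lra.
          assert (I1 := IH (Nat.pred n) u ltac:(lia) Hu').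
          assert (I2 := IH n u ltac:(lia) Hu').
          assert (I3 := IH (S n) u ltac:(lia) Hu').
          specialize (Ha n Hmn). specialize (Hb n Hmn). specialize (Hc n Hmn).
          assert (HE := exp_pos (L * u)).
          set (q := M * ((L * u) ^ k / INR (fact k))) in *.
          assert (Hq : 0 <= q).
          { apply Rmult_le_pos; [lra|]. apply Rdiv_le_0_compat; [apply pow_le; nra|].
            apply INR_fact_lt_0. }
          replace (M * (L * ((L * u) ^ k / INR (fact k)))) with (L * q) by (unfold q; ring).
          set (E := exp (L * u)) in *.
          assert (E * (a n * f (Nat.pred n) u - c n * f n u + b n * f (S n) u) <= E * f' n u)
            by (apply Rmult_le_compat_l; lra).
          assert (J1 : a n * - q <= a n * (E * f (Nat.pred n) u)) by (apply Rmult_le_compat_l; lra).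
          assert (J2 : (L - c n) * - q <= (L - c n) * (E * f n u)) by (apply Rmult_le_compat_l; lra).
          assert (J3 : b n * - q <= b n * (E * f (S n) u)) by (apply Rmult_le_compat_l; lra).
          nra. }
      unfold g in Hg. rewrite Rmult_0_r, exp_0, pow_i in Hg by lia.
      specialize (H0 n Hmn). unfold Rdiv at 1 in Hg. rewrite Rmult_0_l, Rmult_0_r in Hg. lra. }
  intros n t Hn Ht.
  assert (Hlim : is_lim_seq (fun k => - (M * ((L * t) ^ k / INR (fact k)))) (- (M * 0))).
  { apply (is_lim_seq_opp _ (M * 0)). apply (is_lim_seq_scal_l _ M 0).
    apply is_lim_seq_Reals. apply cv_speed_pow_fact. }
  assert (Hle : Rbar_le (- (M * 0)) (exp (L * t) * f n t)).
  { apply (is_lim_seq_le _ (fun _ => exp (L * t) * f n t)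
      (- (M * 0)) (exp (L * t) * f n t) (fun k => step k n t Hn Ht) Hlim).
    apply is_lim_seq_const. }
  simpl in Hle. generalize (exp_pos (L * t)). intros. nra.
Qed.

(** Applying the comparison to [w + e] and [w - e]. *)
Lemma domination (m : nat) (L Tm K : R) (a b c : nat -> R)
  (e e' w w' : nat -> R -> R) :
  0 <= Tm -> rates m L a b c ->
  (forall n t, (Nat.pred m <= n)%nat -> 0 <= t <= Tm -> Rabs (e n t) <= K) ->
  (forall n t, (Nat.pred m <= n)%nat -> 0 <= t <= Tm -> 0 <= w n t) ->
  (forall t, (0 < m)%nat -> 0 <= t <= Tm ->
     Rabs (e (Nat.pred m) t) <= w (Nat.pred m) t) ->
  (forall n, (m <= n)%nat -> Rabs (e n 0) <= w n 0) ->
  (forall n, (m <= n)%nat -> right_continuous0 (e n)) ->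
  (forall n, (m <= n)%nat -> right_continuous0 (w n)) ->
  (forall n t, (m <= n)%nat -> 0 < t <= Tm -> is_derive (e n) t (e' n t)) ->
  (forall n t, (m <= n)%nat -> 0 < t <= Tm -> is_derive (w n) t (w' n t)) ->
  (forall n t, (m <= n)%nat -> 0 < t <= Tm ->
     Rabs (e' n t - generator a b c (fun k => e k t) n)
     <= w' n t - generator a b c (fun k => w k t) n) ->
  forall n t, (Nat.pred m <= n)%nat -> 0 <= t <= Tm -> Rabs (e n t) <= w n t.
Proof.
  intros HTm Hr HK Hw Hbd H0 Hce Hcw Hde Hdw Hres n t Hn Ht.
  apply Rabs_le. split.
  - cut (0 <= w n t + e n t); [lra|].
    apply (comparison m L Tm K a b c (fun n t => w n t + e n t)
             (fun n t => w' n t + e' n t)); auto.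
    + intros k s Hk Hs. specialize (HK k s Hk Hs). specialize (Hw k s Hk Hs).
      apply Rabs_le_between in HK. lra.
    + intros s Hm Hs. specialize (Hbd s Hm Hs). apply Rabs_le_between in Hbd. lra.
    + intros k Hk. specialize (H0 k Hk). apply Rabs_le_between in H0. lra.
    + intros k Hk. now apply right_continuous0_plus; auto.
    + intros k s Hk Hs. apply (is_derive_plus (V := R_NormedModule)); auto.
    + intros k s Hk Hs. specialize (Hres k s Hk Hs). apply Rabs_le_between in Hres.
      unfold generator in *. lra.
  - cut (0 <= w n t - e n t); [lra|].
    apply (comparison m L Tm K a b c (fun n t => w n t - e n t)
             (fun n t => w' n t - e' n t)); auto.
    + intros k s Hk Hs. specialize (HK k s Hk Hs). specialize (Hw k s Hk Hs).
      apply Rabs_le_between in HK. lra.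
    + intros s Hm Hs. specialize (Hbd s Hm Hs). apply Rabs_le_between in Hbd. lra.
    + intros k Hk. specialize (H0 k Hk). apply Rabs_le_between in H0. lra.
    + intros k Hk. now apply right_continuous0_minus; auto.
    + intros k s Hk Hs. apply (is_derive_minus (V := R_NormedModule)); auto.
    + intros k s Hk Hs. specialize (Hres k s Hk Hs). apply Rabs_le_between in Hres.
      unfold generator in *. lra.
Qed.

(** * The sojourn time density as a solution of the backward equations *)

Definition ps_down (n : nat) : R := INR n / (INR n + 1).
Definition ps_up (rho : R) (n : nat) : R := rho / (INR n + 1).
Definition ps_total (rho : R) (n : nat) : R := 1 + rho / (INR n + 1).

Definition ps_generator (rho : R) := generator ps_down (ps_up rho) (ps_total rho).

Lemma ps_rates rho m : 0 < rho -> rates m (1 + rho) ps_down (ps_up rho) (ps_total rho).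
Proof.
  intros Hr. split; intros n _; generalize (pos_INR n); intros Hn;
    unfold ps_down, ps_up, ps_total.
  - apply Rdiv_le_0_compat; lra.
  - apply Rdiv_le_0_compat; lra.
  - assert (INR n / (INR n + 1) <= 1) by (apply Rle_div_l; lra).
    assert (rho / (INR n + 1) <= rho) by (apply Rle_div_l; nra).
    lra.
Qed.

(** The row sums are minus the departure rate of the tagged customer; therefore
    non-negative constants are supersolutions. *)
Lemma ps_generator_const rho x n :
  ps_generator rho (fun _ => x) n = - (x / (INR n + 1)).
Proof.
  unfold ps_generator, generator, ps_down, ps_up, ps_total.
  generalize (pos_INR n). intros. field. lra.
Qed.

(** The right-hand side of the backward equations, which has the correct value at
    [t = 0], where [Derive] says nothing. *)
Definition density (rho : R) (V : nat -> R -> R) (n : nat) (t : R) : R :=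
  - ps_generator rho (fun k => V k t) n.

Lemma generator_right_continuous0 a b c (f : nat -> R -> R) n :
  (forall k, right_continuous0 (f k)) ->
  right_continuous0 (fun t => generator a b c (fun k => f k t) n).
Proof.
  intros H. unfold generator.
  apply right_continuous0_plus; [apply right_continuous0_minus|];
    now apply right_continuous0_scal.
Qed.

Lemma generator_derive a b c (f : nat -> R -> R) (f' : nat -> R) n t :
  (forall k, is_derive (f k) t (f' k)) ->
  is_derive (fun t => generator a b c (fun k => f k t) n) t (generator a b c f' n).
Proof.
  intros H. unfold generator.
  apply (is_derive_plus (V := R_NormedModule)).
  - apply (is_derive_minus (V := R_NormedModule)); now apply is_derive_scal.
  - now apply is_derive_scal.
Qed.

Section Density.

Context (rho : R) (V : nat -> R -> R).
Hypothesis Hrho : 0 < rho.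
Hypothesis HV : is_sojourn_tail rho V.

Local Notation p := (density rho V).

Lemma tail_derive n t : 0 < t -> is_derive (V n) t (- p n t).
Proof.
  intros Ht. evar_last; [now apply (tail_ode _ _ HV)|].
  unfold density, ps_generator, generator, ps_down, ps_up, ps_total. as_reals. ring.
Qed.

Lemma sojourn_density_eq n t : 0 < t -> sojourn_density V n t = p n t.
Proof.
  intros Ht. unfold sojourn_density. rewrite (is_derive_unique _ _ _ (tail_derive n t Ht)). ring.
Qed.

Lemma density_right_continuous0 n : right_continuous0 (p n).
Proof.
  unfold density.
  apply right_continuous0_ext with (fun t => (-1) * ps_generator rho (fun k => V k t) n).
  - intros; ring.
  - apply right_continuous0_scal, generator_right_continuous0.
    apply (tail_right_continuous _ _ HV).
Qed.

Lemma density_init n : p n 0 = / (INR n + 1).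
Proof.
  unfold density, ps_generator, generator, ps_down, ps_up, ps_total.
  rewrite !(tail_init _ _ HV). generalize (pos_INR n). intros. field. lra.
Qed.

(** The coefficients do not depend on time, so the density solves the equations of
    the tail. *)
Lemma density_ode n t : 0 < t ->
  is_derive (p n) t (ps_generator rho (fun k => p k t) n).
Proof.
  intros Ht. unfold density.
  evar_last.
  { apply (is_derive_opp (V := R_NormedModule)).
    apply (generator_derive _ _ _ V (fun k => - p k t)).
    intros k. now apply tail_derive. }
  unfold density, ps_generator, generator, opp. simpl. ring.
Qed.

Lemma density_crude_bound n t : 0 <= t -> Rabs (p n t) <= 2 * (1 + rho).
Proof.
  intros Ht. unfold density, ps_generator, generator.
  destruct (ps_rates rho 0 Hrho) as [A B C].
  specialize (A n (Nat.le_0_l n)). specialize (B n (Nat.le_0_l n)).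
  specialize (C n (Nat.le_0_l n)).
  assert (V1 := tail_bounded _ _ HV (Nat.pred n) t Ht).
  assert (V2 := tail_bounded _ _ HV n t Ht).
  assert (V3 := tail_bounded _ _ HV (S n) t Ht).
  apply Rabs_le. split; nra.
Qed.

Lemma density_nonneg n t : 0 <= t -> 0 <= p n t.
Proof.
  intros Ht.
  apply (comparison 0 (1 + rho) t (2 * (1 + rho)) _ _ _ p
    (fun n t => ps_generator rho (fun k => p k t) n) Ht (ps_rates rho 0 Hrho));
    intros; try lra; try lia.
  - generalize (density_crude_bound n0 t0 (proj1 H0)). intros Hb.
    apply Rabs_le_between in Hb. lra.
  - rewrite density_init. left. apply Rinv_0_lt_compat.
    generalize (pos_INR n0); lra.
  - apply density_right_continuous0.
  - apply density_ode; lra.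
  - apply Rle_refl.
Qed.

Lemma density_le_1 n t : 0 <= t -> p n t <= 1.
Proof.
  intros Ht.
  cut (Rabs (p n t) <= 1).
  { intros H. apply Rabs_le_between in H. lra. }
  apply (domination 0 (1 + rho) t (2 * (1 + rho)) _ _ _ p
    (fun n t => ps_generator rho (fun k => p k t) n)
    (fun _ _ => 1) (fun _ _ => 0) Ht (ps_rates rho 0 Hrho));
    intros; try lra; try lia.
  - now apply density_crude_bound.
  - rewrite density_init. generalize (pos_INR n0). intros.
    rewrite Rabs_pos_eq by (left; apply Rinv_0_lt_compat; lra).
    rewrite <- Rinv_1. apply Rinv_le_contravar; lra.
  - apply density_right_continuous0.
  - apply right_continuous0_const.
  - apply density_ode; lra.
  - apply (is_derive_const (V := R_NormedModule)).
  - fold (ps_generator rho). rewrite ps_generator_const. rewrite Rminus_diag, Rabs_R0.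
    generalize (pos_INR n0). intros.
    assert (0 <= 1 / (INR n0 + 1)) by (apply Rdiv_le_0_compat; lra). lra.
Qed.

(** Only the outgoing terms of the equation are kept: the tagged customer may leave
    before any other event. *)
Lemma density_lower n t : 0 <= t ->
  exp (- (ps_total rho n * t)) / (INR n + 1) <= p n t.
Proof.
  intros Ht. set (c := ps_total rho n).
  assert (H : exp (c * 0) * p n 0 <= exp (c * t) * p n t).
  { apply derive_nonneg_incr0 with
      (h := fun t => exp (c * t) * p n t)
      (h' := fun u => c * exp (c * u) * p n u
                      + exp (c * u) * ps_generator rho (fun k => p k u) n); auto.
    - apply right_continuous0_mult; [|apply density_right_continuous0].
      apply continuous_right_continuous0.
      apply (ex_derive_continuous (V := R_NormedModule)). auto_derive; auto.
    - intros u Hu. evar_last.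
      { apply (is_derive_mult (fun x => exp (c * x)) (p n) u (c * exp (c * u))).
        - auto_derive; [auto | ring].
        - apply density_ode; lra.
        - intros; apply Rmult_comm. }
      unfold plus, mult; simpl. ring.
    - intros u Hu. assert (HE := exp_pos (c * u)).
      unfold ps_generator, generator. fold c.
      destruct (ps_rates rho 0 Hrho) as [A B _].
      assert (0 <= ps_down n * p (Nat.pred n) u)
        by (apply Rmult_le_pos; [apply A; lia | apply density_nonneg; lra]).
      assert (0 <= ps_up rho n * p (S n) u)
        by (apply Rmult_le_pos; [apply B; lia | apply density_nonneg; lra]).
      nra. }
  rewrite Rmult_0_r, exp_0 in H. rewrite density_init in H.
  unfold Rdiv. rewrite exp_Ropp.
  assert (HE := exp_pos (c * t)).
  apply (Rmult_le_reg_l (exp (c * t))); [lra|].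
  rewrite <- Rmult_assoc, Rinv_r by lra. exact H.
Qed.

End Density.

(** * Ray coordinates *)

(** The characteristics of the leading-order equation are [dN/ds = N - 1],
    [dT/ds = N].  The one through [(N, T)] left [T = 0] at the abscissa [xi] with
    [N - 1 = (xi - 1) * exp s]; eliminating [xi], its parameter [s] is the root of
    [travel N s = T], and [U = T - s], [xi = N - U]. *)
Definition travel (N s : R) : R := s + (N - 1) * (1 - exp (- s)).

Lemma exp_le_compat x y : x <= y -> exp x <= exp y.
Proof.
  intros [H| ->]; [left; now apply exp_increasing | apply Rle_refl].
Qed.

Lemma exp_neg_le_1 s : 0 <= s -> exp (- s) <= 1.
Proof. intros. rewrite <- exp_0. apply exp_le_compat. lra. Qed.

Lemma exp_neg_lipschitz s1 s2 : 0 <= s1 <= s2 ->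
  0 <= exp (- s1) - exp (- s2) <= s2 - s1.
Proof.
  intros H. assert (exp (- s2) <= exp (- s1)) by (apply exp_le_compat; lra).
  split; [lra|].
  replace (- s2) with (- s1 + - (s2 - s1)) by ring. rewrite exp_plus.
  generalize (exp_ineq1_le (- (s2 - s1))) (exp_pos (- s1)) (exp_neg_le_1 s1 (proj1 H)).
  nra.
Qed.

(** The slope [1 + (N - 1) * exp (- s)] is at least [Rmin N 1] on [0 <= s].
    Existence, uniqueness and Lipschitz dependence of the root all rest on this. *)
Lemma travel_expand N s1 s2 : 0 < N -> 0 <= s1 <= s2 ->
  Rmin N 1 * (s2 - s1) <= travel N s2 - travel N s1.
Proof.
  intros HN Hs. generalize (exp_neg_lipschitz s1 s2 Hs). intros He.
  unfold travel. destruct (Rle_dec 1 N).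
  - rewrite Rmin_right by lra. nra.
  - rewrite Rmin_left by lra. nra.
Qed.

Lemma Rmin_pos_1 N : 0 < N -> 0 < Rmin N 1.
Proof. intros. apply Rmin_glb_lt; lra. Qed.

Lemma travel_inj N s1 s2 : 0 < N -> 0 <= s1 -> 0 <= s2 ->
  travel N s1 = travel N s2 -> s1 = s2.
Proof.
  intros HN H1 H2 E. generalize (Rmin_pos_1 N HN). intros.
  destruct (Rle_dec s1 s2) as [h|h].
  - generalize (travel_expand N s1 s2 HN (conj H1 h)). nra.
  - assert (h' : s2 <= s1) by lra.
    generalize (travel_expand N s2 s1 HN (conj H2 h')). nra.
Qed.

Lemma travel_onto N T : 0 < N -> 0 <= T -> exists s, 0 <= s /\ travel N s = T.
Proof.
  intros HN HT. generalize (Rmin_pos_1 N HN). intros Hc.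
  set (b := T / Rmin N 1).
  assert (Hb : 0 <= b) by (apply Rdiv_le_0_compat; lra).
  assert (E0 : travel N 0 = 0) by (unfold travel; rewrite Ropp_0, exp_0; ring).
  assert (Eb : T <= travel N b).
  { generalize (travel_expand N 0 b HN (conj (Rle_refl 0) Hb)). rewrite E0.
    replace (Rmin N 1 * (b - 0)) with T by (unfold b; field; lra). lra. }
  destruct (IVT_gen (travel N) 0 b T) as [s [Hs Es]].
  - intros x. apply derivable_continuous_pt. unfold travel.
    apply ex_derive_Reals_0. auto_derive; auto.
  - rewrite E0, Rmin_left, Rmax_right by lra. lra.
  - exists s. rewrite Rmin_left in Hs by lra. split; [lra | exact Es].
Qed.

(** The branch condition [u < N] is the same as [0 <= T - u]: on [(T - N, 0)] the
    function [travel N] is increasing, hence negative, and has no root there. *)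
Lemma is_U_travel N T u : 0 < N -> 0 <= T ->
  (is_U N T u <-> 0 <= T - u /\ travel N (T - u) = T).
Proof.
  intros HN HT. unfold is_U, travel.
  replace (- (T - u)) with (u - T) by ring.
  split.
  - intros [Hu [H1 H2]].
    assert (E : T - u + (N - 1) * (1 - exp (u - T)) = T).
    { destruct (Req_dec N 1) as [->|Hne].
      - rewrite (H2 eq_refl). ring.
      - rewrite <- (H1 Hne). field. lra. }
    split; [|exact E].
    destruct (Rle_dec 0 (T - u)) as [|h]; [assumption|exfalso].
    assert (G1 := exp_ineq1_le (u - T)).
    assert (Hv : 0 < u - T) by lra.
    assert (G2 := exp_ineq1_le (- (u - T))). rewrite exp_Ropp in G2.
    assert (Hp := exp_pos (u - T)).
    assert (exp (u - T) * (1 - (u - T)) <= 1).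
    { apply (Rmult_le_compat_l (exp (u - T))) in G2; [|lra].
      rewrite Rinv_r in G2 by lra. lra. }
    destruct (Rle_dec 1 N); [nra|].
    (* With v = u - T: e^v - 1 <= v e^v, and (1 - N) e^v < 1 because v < N. *)
    assert (G3 := exp_ineq1_le (- N)). rewrite exp_Ropp in G3.
    assert (HpN := exp_pos N).
    assert ((1 - N) * exp N <= 1).
    { apply (Rmult_le_compat_l (exp N)) in G3; [|lra].
      rewrite Rinv_r in G3 by lra. lra. }
    assert (exp (u - T) < exp N) by (apply exp_increasing; lra).
    assert ((1 - N) * exp (u - T) < 1) by nra.
    nra.
  - intros [Hs E].
    assert (He : 0 < exp (u - T) <= 1).
    { split; [apply exp_pos|]. rewrite <- exp_0. apply exp_le_compat. lra. }
    split; [nra|]. split.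
    + intros Hne. apply (Rmult_eq_reg_r (N - 1)); [|lra].
      unfold Rdiv. rewrite Rmult_assoc, Rinv_l by lra. lra.
    + intros ->. lra.
Qed.

Lemma is_U_U N T : 0 < N -> 0 <= T -> is_U N T (U N T).
Proof.
  intros HN HT. unfold U. apply epsilon_spec.
  destruct (travel_onto N T HN HT) as [s [Hs E]].
  exists (T - s). apply is_U_travel; auto.
  replace (T - (T - s)) with s by ring. auto.
Qed.

Lemma is_U_unique N T u : 0 < N -> 0 <= T -> (is_U N T u <-> u = U N T).
Proof.
  intros HN HT. split; [|intros ->; now apply is_U_U].
  intros H. apply is_U_travel in H; auto. destruct H as [H1 H2].
  destruct (proj1 (is_U_travel N T _ HN HT) (is_U_U N T HN HT)) as [H3 H4].
  cut (T - u = T - U N T); [lra|].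
  apply travel_inj with N; congruence.
Qed.

Definition ray_time (N T : R) : R := T - U N T.

Lemma ray_time_nonneg N T : 0 < N -> 0 <= T -> 0 <= ray_time N T.
Proof. intros HN HT. apply (proj1 (is_U_travel N T _ HN HT) (is_U_U N T HN HT)). Qed.

Lemma travel_ray_time N T : 0 < N -> 0 <= T -> travel N (ray_time N T) = T.
Proof. intros HN HT. apply (proj1 (is_U_travel N T _ HN HT) (is_U_U N T HN HT)). Qed.

Lemma ray_time_unique N T s : 0 < N -> 0 <= s -> travel N s = T -> 0 <= T ->
  ray_time N T = s.
Proof.
  intros HN Hs E HT. apply travel_inj with N; auto using ray_time_nonneg.
  rewrite travel_ray_time; auto.
Qed.

Lemma ray_time_0 N : 0 < N -> ray_time N 0 = 0.
Proof.
  intros HN. apply ray_time_unique; try lra. unfold travel. rewrite Ropp_0, exp_0. ring.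
Qed.

Lemma ray_time_1 T : 0 <= T -> ray_time 1 T = T.
Proof. intros HT. apply ray_time_unique; try lra. unfold travel. ring. Qed.

Definition decay (N T : R) : R := exp (- ray_time N T).
Definition ray_origin (N T : R) : R := N - U N T.

Lemma decay_bounds N T : 0 < N -> 0 <= T -> 0 < decay N T <= 1.
Proof.
  intros HN HT. split; [apply exp_pos | apply exp_neg_le_1; now apply ray_time_nonneg].
Qed.

Lemma ray_origin_decay N T : 0 < N -> 0 <= T ->
  ray_origin N T = 1 + (N - 1) * decay N T.
Proof.
  intros HN HT. generalize (travel_ray_time N T HN HT).
  unfold ray_origin, decay, travel, ray_time. lra.
Qed.

Lemma ray_origin_lower N T : 0 < N -> 0 <= T -> Rmin N 1 <= ray_origin N T.
Proof.
  intros HN HT. rewrite ray_origin_decay by auto.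
  generalize (decay_bounds N T HN HT). intros Hd.
  destruct (Rle_dec 1 N).
  - rewrite Rmin_right by lra. nra.
  - rewrite Rmin_left by lra. nra.
Qed.

Lemma ray_origin_pos N T : 0 < N -> 0 <= T -> 0 < ray_origin N T.
Proof.
  intros HN HT. generalize (ray_origin_lower N T HN HT) (Rmin_pos_1 N HN). lra.
Qed.

Lemma ray_time_upper N T : 0 < N -> 0 <= T -> ray_time N T <= T + 1.
Proof.
  intros HN HT. generalize (travel_ray_time N T HN HT) (decay_bounds N T HN HT).
  unfold travel. fold (decay N T). nra.
Qed.

Lemma ray_time_lipschitz N T N' T' : 0 < N -> 0 <= T -> 0 < N' -> 0 <= T' ->
  Rmin N 1 * Rabs (ray_time N' T' - ray_time N T) <= Rabs (N' - N) + Rabs (T' - T).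
Proof.
  intros HN HT HN' HT'.
  generalize (travel_ray_time N T HN HT) (travel_ray_time N' T' HN' HT')
    (ray_time_nonneg N T HN HT) (ray_time_nonneg N' T' HN' HT')
    (decay_bounds N' T' HN' HT').
  unfold decay. set (s := ray_time N T). set (s' := ray_time N' T').
  intros E E' Hs Hs' Hd.
  assert (D : travel N s' - travel N s = - (N' - N) * (1 - exp (- s')) + (T' - T)).
  { replace (travel N s') with (travel N' s' - (N' - N) * (1 - exp (- s')))
      by (unfold travel; ring).
    rewrite E, E'. ring. }
  assert (B : Rabs (travel N s' - travel N s) <= Rabs (N' - N) + Rabs (T' - T)).
  { rewrite D. eapply Rle_trans; [apply Rabs_triang|].
    rewrite Rabs_mult, Rabs_Ropp.
    assert (Rabs (1 - exp (- s')) <= 1) by (apply Rabs_le; lra).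
    generalize (Rabs_pos (N' - N)). nra. }
  destruct (Rle_dec s s') as [h|h].
  - rewrite (Rabs_pos_eq (s' - s)) by lra.
    generalize (travel_expand N s s' HN (conj Hs h)) (Rle_abs (travel N s' - travel N s)). lra.
  - assert (h' : s' <= s) by lra.
    rewrite (Rabs_minus_sym s' s), (Rabs_pos_eq (s - s')) by lra.
    generalize (travel_expand N s' s HN (conj Hs' h')) (Rle_abs (- (travel N s' - travel N s))).
    rewrite Rabs_Ropp. lra.
Qed.

Lemma ray_time_right_continuous0 N : 0 < N -> right_continuous0 (ray_time N).
Proof.
  intros HN. generalize (Rmin_pos_1 N HN). intros Hc.
  unfold right_continuous0. apply filterlim_locally. intros eps.
  assert (He : 0 < Rmin N 1 * eps) by (apply Rmult_lt_0_compat; [lra | apply cond_pos]).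
  exists (mkposreal _ He). intros t Ht Ht0.
  change (Rabs (t - 0) < Rmin N 1 * eps) in Ht.
  change (Rabs (ray_time N t - ray_time N 0) < eps).
  generalize (ray_time_lipschitz N 0 N t HN (Rle_refl 0) HN (Rlt_le _ _ Ht0)).
  rewrite Rminus_diag, Rabs_R0. nra.
Qed.

(** Caratheodory's form of differentiability: a slope function continuous at [x].
    It turns implicit differentiation into algebra. *)
Lemma is_derive_slope (f : R -> R) (x l : R) :
  is_derive f x l ->
  exists q : R -> R, (forall x', f x' - f x = (x' - x) * q x')
                     /\ continuous q x /\ q x = l.
Proof.
  intros H. apply is_derive_Reals in H.
  exists (fun x' => if Req_EM_T x' x then l else (f x' - f x) / (x' - x)).
  split; [|split].
  - intros x'. destruct (Req_EM_T x' x) as [->|h]; [ring|]. field. lra.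
  - apply filterlim_locally. intros eps.
    destruct (H eps (cond_pos eps)) as [d Hd]. exists d. intros x' Hx'.
    change (Rabs (x' - x) < d) in Hx'.
    destruct (Req_EM_T x x) as [_|h]; [|now elim h].
    destruct (Req_EM_T x' x) as [->|h]; [apply ball_center|].
    specialize (Hd (x' - x) ltac:(lra) Hx').
    assert (Ex : x + (x' - x) = x') by ring. rewrite Ex in Hd. exact Hd.
  - destruct (Req_EM_T x x) as [_|h]; [reflexivity | now elim h].
Qed.

Lemma slope_is_derive (f q : R -> R) (x : R) :
  locally x (fun x' => f x' - f x = (x' - x) * q x') -> continuous q x ->
  is_derive f x (q x).
Proof.
  intros E Hc. apply is_derive_Reals. intros eps Heps.
  destruct (filter_and _ _ E (proj1 (filterlim_locally q (q x)) Hc (mkposreal eps Heps)))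
    as [d Hd].
  exists d. intros h Hh0 Hh. assert (Exh : x + h - x = h) by ring.
  destruct (Hd (x + h)) as [E' Hb].
  { change (Rabs (x + h - x) < d). rewrite Exh. exact Hh. }
  rewrite E', Exh. replace (h * q (x + h) / h) with (q (x + h)) by (field; auto).
  exact Hb.
Qed.

Lemma ray_time_continuous_along (X Y : R -> R) (x : R) :
  locally x (fun x' => 0 < X x' /\ 0 <= Y x') ->
  continuous X x -> continuous Y x ->
  continuous (fun x => ray_time (X x) (Y x)) x.
Proof.
  intros Hdom HX HY.
  destruct (locally_singleton _ _ Hdom) as [HX0 HY0].
  assert (Hc := Rmin_pos_1 _ HX0).
  apply filterlim_locally. intros eps.
  assert (He : 0 < Rmin (X x) 1 * eps / 2).
  { generalize (Rmult_lt_0_compat _ _ Hc (cond_pos eps)). lra. }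
  generalize (filter_and _ _ Hdom (filter_and _ _
    (proj1 (filterlim_locally X (X x)) HX (mkposreal _ He))
    (proj1 (filterlim_locally Y (Y x)) HY (mkposreal _ He)))).
  apply filter_imp. intros x' [[H1 H2] [H3 H4]].
  change (Rabs (X x' - X x) < Rmin (X x) 1 * eps / 2) in H3.
  change (Rabs (Y x' - Y x) < Rmin (X x) 1 * eps / 2) in H4.
  change (Rabs (ray_time (X x') (Y x') - ray_time (X x) (Y x)) < eps).
  generalize (ray_time_lipschitz _ _ _ _ HX0 HY0 H1 H2). nra.
Qed.

(** Implicit differentiation along a curve of the [(N, T)] plane, which gives both
    partial derivatives at once. *)
Lemma ray_time_derive_along (X Y : R -> R) (dX dY x : R) :
  locally x (fun x' => 0 < X x' /\ 0 <= Y x') ->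
  is_derive X x dX -> is_derive Y x dY ->
  is_derive (fun x => ray_time (X x) (Y x)) x
    ((dY - dX * (1 - decay (X x) (Y x))) / ray_origin (X x) (Y x)).
Proof.
  intros Hdom HX HY.
  destruct (locally_singleton _ _ Hdom) as [HX0 HY0].
  set (s := fun x => ray_time (X x) (Y x)).
  assert (Hs : continuous s x).
  { apply ray_time_continuous_along; auto.
    - apply (ex_derive_continuous (V := R_NormedModule)). now exists dX.
    - apply (ex_derive_continuous (V := R_NormedModule)). now exists dY. }
  assert (Hexp : is_derive (fun s => exp (- s)) (s x) (- decay (X x) (Y x))).
  { auto_derive; [auto|]. unfold decay, s. ring. }
  apply is_derive_slope in HX. destruct HX as [qX [EX [CX VX]]].
  apply is_derive_slope in HY. destruct HY as [qY [EY [CY VY]]].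
  apply is_derive_slope in Hexp. destruct Hexp as [Q [EQ [CQ VQ]]].
  set (D := fun x' => 1 - (X x - 1) * Q (s x')).
  assert (CD : continuous D x).
  { apply (continuous_minus (V := R_NormedModule)); [apply continuous_const|].
    apply (continuous_scal_r (V := R_NormedModule) (X x - 1)).
    now apply continuous_comp. }
  assert (VD : D x = ray_origin (X x) (Y x)).
  { unfold D. rewrite VQ, ray_origin_decay by auto. ring. }
  assert (PD := ray_origin_pos _ _ HX0 HY0). rewrite <- VD in PD.
  set (q := fun x' => (qY x' - qX x' * (1 - exp (- s x'))) / D x').
  assert (Cq : continuous q x).
  { apply (continuous_mult (K := R_AbsRing)).
    - apply (continuous_minus (V := R_NormedModule)); [exact CY|].
      apply (continuous_mult (K := R_AbsRing)); [exact CX|].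
      apply (continuous_minus (V := R_NormedModule)); [apply continuous_const|].
      apply (continuous_comp s (fun s => exp (- s))); [exact Hs|].
      apply (ex_derive_continuous (V := R_NormedModule)). auto_derive; auto.
    - apply (continuous_comp D Rinv); [exact CD|].
      apply continuous_Rinv. lra. }
  assert (PDl : locally x (fun x' => 0 < D x')).
  { apply (CD (fun y => 0 < y)). now apply (open_gt 0). }
  assert (El : locally x (fun x' => s x' - s x = (x' - x) * q x')).
  { generalize (filter_and _ _ Hdom PDl). apply filter_imp.
    intros x' [[HX1 HY1] HD1].
    apply (Rmult_eq_reg_r (D x')); [|lra].
    replace ((x' - x) * q x' * D x')
      with ((x' - x) * qY x' - (x' - x) * qX x' * (1 - exp (- s x')))
      by (unfold q; field; lra).
    rewrite <- EX, <- EY.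
    generalize (travel_ray_time _ _ HX0 HY0) (travel_ray_time _ _ HX1 HY1).
    fold (s x) (s x'). unfold travel. intros E0 E1.
    unfold D. specialize (EQ (s x')).
    replace ((s x' - s x) * (1 - (X x - 1) * Q (s x')))
      with ((s x' - s x) - (X x - 1) * ((s x' - s x) * Q (s x'))) by ring.
    rewrite <- EQ, <- E0, <- E1. ring. }
  evar_last; [now apply (slope_is_derive s q)|].
  unfold q. rewrite VX, VY, VD. unfold decay, s. reflexivity.
Qed.

(** * Polynomials in the ray coordinates *)

(** Polynomials in [s], [y = exp (- s)] and [z = 1 / xi].  They contain both terms
    of the expansion, are stable under both partial derivatives, and are bounded
    on [d <= N], [0 <= T <= Tm]; Taylor remainders of any order can thus be
    estimated without computing a high derivative. *)
Inductive ray_poly : Type :=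
| RConst (r : R)
| RTime
| RDecay
| RInv
| RAdd (e1 e2 : ray_poly)
| RMul (e1 e2 : ray_poly).

Declare Scope ray_scope.
Delimit Scope ray_scope with ray.
Bind Scope ray_scope with ray_poly.
Notation "a + b" := (RAdd a b) : ray_scope.
Notation "a * b" := (RMul a b) : ray_scope.

Fixpoint eval (e : ray_poly) (N T : R) : R :=
  match e with
  | RConst r => r
  | RTime => ray_time N T
  | RDecay => decay N T
  | RInv => / ray_origin N T
  | RAdd e1 e2 => eval e1 N T + eval e2 N T
  | RMul e1 e2 => eval e1 N T * eval e2 N T
  end.

(** These rules come from [ds/dN = - (1 - y) / xi] and [dxi/dN = N * y / xi], where
    [N * y = xi - 1 + y]. *)
Fixpoint ray_dN (e : ray_poly) : ray_poly :=
  match e with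
  | RConst _ => RConst 0
  | RTime => (RDecay + RConst (-1)) * RInv
  | RDecay => RDecay * (RConst 1 + RConst (-1) * RDecay) * RInv
  | RInv => RInv * RInv * (RConst (-1) + (RConst 1 + RConst (-1) * RDecay) * RInv)
  | RAdd e1 e2 => ray_dN e1 + ray_dN e2
  | RMul e1 e2 => ray_dN e1 * e2 + e1 * ray_dN e2
  end%ray.

(** These rules come from [ds/dT = 1 / xi] and [dxi/dT = - (xi - 1) / xi]. *)
Fixpoint ray_dT (e : ray_poly) : ray_poly :=
  match e with
  | RConst _ => RConst 0
  | RTime => RInv
  | RDecay => RConst (-1) * RDecay * RInv
  | RInv => RInv * RInv * (RConst 1 + RConst (-1) * RInv)
  | RAdd e1 e2 => ray_dT e1 + ray_dT e2
  | RMul e1 e2 => ray_dT e1 * e2 + e1 * ray_dT e2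
  end%ray.

Lemma locally_pos x : 0 < x -> locally x (fun x' => 0 < x').
Proof. intros H. now apply (open_gt 0). Qed.

Lemma decay_derive (s : R -> R) (ds x : R) :
  is_derive s x ds -> is_derive (fun x => exp (- s x)) x (- ds * exp (- s x)).
Proof.
  intros H. auto_derive.
  - now exists ds.
  - replace (Derive (fun x => s x) x) with ds by (symmetry; now apply is_derive_unique).
    ring.
Qed.

Lemma eval_dN e N T : 0 < N -> 0 <= T ->
  is_derive (fun N => eval e N T) N (eval (ray_dN e) N T).
Proof.
  intros HN HT.
  assert (Hs : is_derive (fun N => ray_time N T) N (- (1 - decay N T) / ray_origin N T)).
  { evar_last.
    { apply (ray_time_derive_along (fun N => N) (fun _ => T) 1 0).
      - generalize (locally_pos N HN). apply filter_imp. auto.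
      - apply (is_derive_id (K := R_AbsRing)).
      - apply (is_derive_const (V := R_NormedModule)). }
    as_reals. unfold Rdiv. ring. }
  assert (Hy : is_derive (fun N => decay N T) N
            (- (- (1 - decay N T) / ray_origin N T) * decay N T))
    by exact (decay_derive _ _ _ Hs).
  assert (Po := ray_origin_pos N T HN HT).
  assert (Eo := ray_origin_decay N T HN HT).
  induction e as [r| | | |e1 IH1 e2 IH2|e1 IH1 e2 IH2]; simpl.
  - apply (is_derive_const (V := R_NormedModule)).
  - evar_last; [exact Hs|]. as_reals. field. lra.
  - evar_last; [exact Hy|]. as_reals. field. lra.
  - apply is_derive_ext_loc with (fun N => / (1 + (N - 1) * decay N T)).
    { generalize (locally_pos N HN). apply filter_imp. intros M HM.
      now rewrite ray_origin_decay. }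
    auto_derive.
    + change (N + - (1)) with (N - 1). rewrite <- Eo.
      split; [eexists; exact Hy | split; [lra | auto]].
    + change (N + - (1)) with (N - 1).
      assert (HD : Derive (fun x : R => decay x T) N = _) by exact (is_derive_unique _ _ _ Hy).
      rewrite HD, <- Eo.
      replace (N - 1) with ((ray_origin N T - 1) / decay N T).
      2:{ rewrite Eo. field. generalize (decay_bounds N T HN HT). lra. }
      field. generalize (decay_bounds N T HN HT). lra.
  - now apply (is_derive_plus (V := R_NormedModule)).
  - evar_last; [apply (is_derive_mult _ _ _ _ _ IH1 IH2); intros; apply Rmult_comm|].
    reflexivity.
Qed.

Lemma eval_dT e N T : 0 < N -> 0 < T ->
  is_derive (fun T => eval e N T) T (eval (ray_dT e) N T).
Proof.
  intros HN HT. assert (HT' := Rlt_le _ _ HT).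
  assert (Hs : is_derive (fun T => ray_time N T) T (/ ray_origin N T)).
  { evar_last.
    { apply (ray_time_derive_along (fun _ => N) (fun T => T) 0 1).
      - generalize (locally_pos T HT). apply filter_imp. intros; split; lra.
      - apply (is_derive_const (V := R_NormedModule)).
      - apply (is_derive_id (K := R_AbsRing)). }
    as_reals. unfold Rdiv. ring. }
  assert (Hy : is_derive (fun T => decay N T) T (- / ray_origin N T * decay N T))
    by exact (decay_derive _ _ _ Hs).
  assert (Po := ray_origin_pos N T HN HT').
  assert (Eo := ray_origin_decay N T HN HT').
  induction e as [r| | | |e1 IH1 e2 IH2|e1 IH1 e2 IH2]; simpl.
  - apply (is_derive_const (V := R_NormedModule)).
  - exact Hs.
  - evar_last; [exact Hy|]. as_reals. field. lra.
  - apply is_derive_ext_loc with (fun T => / (1 + (N - 1) * decay N T)).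
    { generalize (locally_pos T HT). apply filter_imp. intros M HM.
      rewrite ray_origin_decay; auto. lra. }
    auto_derive.
    + change (N + - (1)) with (N - 1). rewrite <- Eo.
      split; [eexists; exact Hy | split; [lra | auto]].
    + change (N + - (1)) with (N - 1).
      assert (HD : Derive (fun x : R => decay N x) T = _) by exact (is_derive_unique _ _ _ Hy).
      rewrite HD, <- Eo.
      replace (N - 1) with ((ray_origin N T - 1) / decay N T).
      2:{ rewrite Eo. field. generalize (decay_bounds N T HN HT'). lra. }
      field. generalize (decay_bounds N T HN HT'). lra.
  - now apply (is_derive_plus (V := R_NormedModule)).
  - evar_last; [apply (is_derive_mult _ _ _ _ _ IH1 IH2); intros; apply Rmult_comm|].
    reflexivity.
Qed.

Lemma eval_right_continuous0 e N : 0 < N -> right_continuous0 (fun T => eval e N T).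
Proof.
  intros HN. assert (Hs := ray_time_right_continuous0 N HN).
  assert (Hy : right_continuous0 (decay N)).
  { unfold right_continuous0, decay.
    apply (filterlim_comp _ _ _ (ray_time N) (fun s => exp (- s)) (at_right 0)
      (locally (ray_time N 0))); [exact Hs|].
    apply (continuous_comp Ropp exp).
    - apply (continuous_opp (V := R_NormedModule)), continuous_id.
    - apply continuous_exp. }
  induction e as [r| | | |e1 IH1 e2 IH2|e1 IH1 e2 IH2]; simpl.
  - apply right_continuous0_const.
  - exact Hs.
  - exact Hy.
  - apply right_continuous0_ext with (fun T => / (1 + (N - 1) * decay N T)).
    { intros t Ht. now rewrite ray_origin_decay. }
    apply (filterlim_comp _ _ _ (fun T => 1 + (N - 1) * decay N T) Rinv (at_right 0)
      (locally (1 + (N - 1) * decay N 0))).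
    + apply (right_continuous0_plus (fun _ => 1)).
      * apply right_continuous0_const.
      * now apply right_continuous0_scal.
    + apply continuous_Rinv. rewrite <- ray_origin_decay by lra.
      generalize (ray_origin_pos N 0 HN (Rle_refl 0)). lra.
  - now apply right_continuous0_plus.
  - now apply right_continuous0_mult.
Qed.

(** The bound is uniform up to [N = + infinity], so that the comparison can run over
    all large queue lengths at once. *)
Lemma eval_bounded e d Tm : 0 < d <= 1 -> 0 <= Tm ->
  exists C, 0 <= C /\
    forall N T, d <= N -> 0 <= T <= Tm -> Rabs (eval e N T) <= C.
Proof.
  intros Hd HTm.
  induction e as [r| | | |e1 [C1 [P1 IH1]] e2 [C2 [P2 IH2]]|e1 [C1 [P1 IH1]] e2 [C2 [P2 IH2]]]; simpl.
  - exists (Rabs r). split; [apply Rabs_pos | intros; apply Rle_refl].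
  - exists (Tm + 1). split; [lra|]. intros N T HN HT.
    rewrite Rabs_pos_eq by (apply ray_time_nonneg; lra).
    generalize (ray_time_upper N T ltac:(lra) ltac:(lra)). lra.
  - exists 1. split; [lra|]. intros N T HN HT.
    generalize (decay_bounds N T ltac:(lra) ltac:(lra)). intros.
    rewrite Rabs_pos_eq; lra.
  - exists (/ d). split; [left; apply Rinv_0_lt_compat; lra|]. intros N T HN HT.
    generalize (ray_origin_lower N T ltac:(lra) ltac:(lra)). intros H.
    assert (d <= Rmin N 1) by (apply Rmin_glb; lra).
    rewrite Rabs_pos_eq by (left; apply Rinv_0_lt_compat; lra).
    apply Rinv_le_contravar; lra.
  - exists (C1 + C2). split; [lra|]. intros N T HN HT.
    eapply Rle_trans; [apply Rabs_triang|].
    generalize (IH1 N T HN HT) (IH2 N T HN HT). lra.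
  - exists (C1 * C2). split; [now apply Rmult_le_pos|]. intros N T HN HT.
    rewrite Rabs_mult. apply Rmult_le_compat; auto using Rabs_pos.
Qed.

Definition ray_P0 : ray_poly := (RDecay * RInv)%ray.

(** In these coordinates [xi + eta - 1 = N - 1 = (xi - 1) / y], and the logarithm of
    the correction term is [s]; all the factors [xi - 1] in denominators cancel, and
    with them the singularity at [N = 1]. *)
Definition ray_P1 : ray_poly :=
  (RInv * RInv * RInv *
     (RConst (-1/2) * (RConst 1 + RConst (-1) * RInv) * (RConst 2 + RConst (-3) * RInv)
      + RConst (3/2) * RDecay
        * (RConst 2 + RConst (-2) * RInv + RConst (-3) * (RInv * RInv))
      + RConst (-1/2) * (RDecay * RDecay * RDecay)
        * (RConst 2 + RConst 4 * RInv + RConst 3 * (RInv * RInv))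
      + RConst (-2) * RTime * RDecay * (RConst 2 * RInv + RConst (-3) * (RInv * RInv)))
   + RConst (-1/2) * (RDecay * RDecay) * (RInv * RInv)
     * (RConst 2 + RConst 2 * RInv + RConst (-5) * (RInv * RInv)
        + RConst (-15) * (RInv * RInv * RInv)))%ray.

Lemma P0_eval N T : 0 < N -> 0 <= T -> P0 N T = eval ray_P0 N T.
Proof.
  intros HN HT. unfold P0, ray_P0. simpl. unfold decay, ray_time, ray_origin.
  replace (- (T - U N T)) with (U N T - T) by ring. reflexivity.
Qed.

Lemma P1_generic_eval N T : 0 < N -> 0 <= T -> N <> 1 ->
  P1_generic N T = eval ray_P1 N T.
Proof.
  intros HN HT HN1. unfold P1_generic, P1_formula.
  assert (Po := ray_origin_pos N T HN HT).
  assert (Eo := ray_origin_decay N T HN HT).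
  assert (Hy := decay_bounds N T HN HT).
  fold (ray_origin N T).
  assert (Es : ray_origin N T + U N T - 1 = N - 1) by (unfold ray_origin; ring).
  rewrite Es.
  assert (Ex : ray_origin N T - 1 = (N - 1) * decay N T) by lra.
  assert (El : ln (Rabs ((N - 1) / (ray_origin N T - 1))) = ray_time N T).
  { rewrite Ex. replace ((N - 1) / ((N - 1) * decay N T)) with (/ decay N T)
      by (field; lra).
    unfold decay. rewrite exp_Ropp, Rinv_inv, Rabs_pos_eq by (left; apply exp_pos).
    apply ln_exp. }
  rewrite El. simpl.
  assert (EN : N - 1 = (ray_origin N T - 1) / decay N T) by (rewrite Ex; field; lra).
  rewrite EN.
  assert (ray_origin N T - 1 <> 0).
  { rewrite Ex. apply Rmult_integral_contrapositive_currified; lra. }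
  field. lra.
Qed.

Lemma eval_P1_at_1 T : 0 <= T ->
  eval ray_P1 1 T = (2 * T - 9 / 2) * exp (- T) + 8 * exp (- (2 * T))
        - 9 / 2 * exp (- (3 * T)).
Proof.
  intros HT.
  assert (Eo : ray_origin 1 T = 1) by (rewrite ray_origin_decay by lra; ring).
  replace (- (2 * T)) with (- T + - T) by ring.
  replace (- (3 * T)) with (- T + - T + - T) by ring.
  rewrite !exp_plus. simpl. rewrite Eo. unfold decay. rewrite ray_time_1 by lra. field.
Qed.

Lemma P1_generic_lim T : 0 < T ->
  is_lim (fun N => P1_generic N T) 1 (eval ray_P1 1 T).
Proof.
  intros HT.
  apply is_lim_ext_loc with (fun N => eval ray_P1 N T).
  { exists posreal_one. intros N HN HN1.
    change (Rabs (N - 1) < 1) in HN. apply Rabs_def2 in HN.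
    symmetry. apply P1_generic_eval; lra. }
  apply (is_lim_continuity (fun N => eval ray_P1 N T) 1). apply derivable_continuous_pt.
  exists (eval (ray_dN ray_P1) 1 T). apply is_derive_Reals. apply eval_dN; lra.
Qed.

Lemma P1_eval N T : 0 < N -> 0 < T -> P1 N T = eval ray_P1 N T.
Proof.
  intros HN HT. unfold P1. destruct (Req_EM_T N 1) as [->|h].
  - now rewrite (is_lim_unique _ _ _ (P1_generic_lim T HT)).
  - apply P1_generic_eval; lra.
Qed.

Lemma eval_init N : 0 < N ->
  eval ray_P0 N 0 = / N /\ eval ray_P1 N 0 = - (/ N ^ 2).
Proof.
  intros HN. simpl.
  assert (Ed : decay N 0 = 1) by (unfold decay; rewrite ray_time_0, Ropp_0, exp_0 by lra; reflexivity).
  assert (Eo : ray_origin N 0 = N) by (rewrite ray_origin_decay, Ed by lra; ring).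
  rewrite Ed, Eo, ray_time_0 by lra. split; field; lra.
Qed.

Lemma ray_coordinates_N N T : 0 < N -> 0 <= T ->
  N = 1 + (ray_origin N T - 1) / decay N T.
Proof.
  intros HN HT. rewrite ray_origin_decay by auto. field.
  generalize (decay_bounds N T HN HT). lra.
Qed.

(** Multiply the backward equations by [N + / rho] and expand in powers of [/ rho]:
    this is the coefficient of [/ rho ^ 2] and [transport_P1] that of [/ rho ^ 3].
    Both are ordinary equations along the rays, where
    [N * d/dT + (N - 1) * d/dN = d/ds]. *)
Lemma transport_P0 N T : 0 < N -> 0 <= T ->
  N * eval (ray_dT ray_P0) N T
  = (1 - N) * eval (ray_dN ray_P0) N T - eval ray_P0 N T.
Proof.
  intros HN HT.
  generalize (ray_origin_pos N T HN HT) (decay_bounds N T HN HT)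
    (ray_coordinates_N N T HN HT).
  simpl. generalize (ray_origin N T) (decay N T). intros xi y Hxi Hy EN.
  clear HN. subst N. field. lra.
Qed.

Lemma transport_P1 N T : 0 < N -> 0 <= T ->
  eval (ray_dT ray_P0) N T + N * eval (ray_dT ray_P1) N T
  = (N + 1) / 2 * eval (ray_dN (ray_dN ray_P0)) N T
    + (1 - N) * eval (ray_dN ray_P1) N T - eval ray_P1 N T.
Proof.
  intros HN HT.
  generalize (ray_origin_pos N T HN HT) (decay_bounds N T HN HT)
    (ray_coordinates_N N T HN HT).
  simpl. generalize (ray_origin N T) (decay N T) (ray_time N T).
  intros xi y s Hxi Hy EN.
  clear HN. subst N. field. lra.
Qed.

(** * The approximation on the fluid scale *)

Lemma taylor2 (f f1 f2 : R -> R) (C x h : R) :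
  (forall u, Rabs (u - x) <= Rabs h ->
     is_derive f u (f1 u) /\ is_derive f1 u (f2 u) /\ Rabs (f2 u) <= C) ->
  Rabs (f (x + h) - f x - h * f1 x) <= C * h ^ 2.
Proof.
  intros H.
  assert (Exh : x + h - x = h) by ring.
  assert (H1 : forall u, Rabs (u - x) <= Rabs h -> Rabs (f1 u - f1 x) <= C * Rabs h).
  { intros u Hu.
    assert (HC : 0 <= C).
    { destruct (H u Hu) as [_ [_ HC]]. generalize (Rabs_pos (f2 u)). lra. }
    apply Rle_trans with (C * Rabs (u - x)); [|now apply Rmult_le_compat_l].
    apply bounded_variation with f2.
    intros t Ht. destruct (H t) as [_ H']; [lra | exact H']. }
  assert (B : Rabs ((f (x + h) - (x + h) * f1 x) - (f x - x * f1 x))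
              <= C * Rabs h * Rabs (x + h - x)).
  { apply bounded_variation with (h := fun u => f u - u * f1 x)
      (dh := fun u => f1 u - f1 x).
    rewrite Exh. intros t Ht. split; [|now apply H1].
    destruct (H t Ht) as [Hf _].
    apply (is_derive_minus (V := R_NormedModule)); [exact Hf|].
    auto_derive; [auto | ring]. }
  rewrite Exh in B.
  replace (f (x + h) - f x - h * f1 x)
    with ((f (x + h) - (x + h) * f1 x) - (f x - x * f1 x)) by ring.
  rewrite <- (pow2_abs h). lra.
Qed.

Lemma taylor3 (f f1 f2 f3 : R -> R) (C x h : R) :
  (forall u, Rabs (u - x) <= Rabs h ->
     is_derive f u (f1 u) /\ is_derive f1 u (f2 u) /\ is_derive f2 u (f3 u)
     /\ Rabs (f3 u) <= C) ->
  Rabs (f (x + h) - f x - h * f1 x - h ^ 2 / 2 * f2 x) <= C * Rabs h ^ 3.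
Proof.
  intros H.
  assert (Exh : x + h - x = h) by ring.
  set (k := fun u => f u - u * f1 x - (u - x) ^ 2 / 2 * f2 x).
  assert (B : Rabs (k (x + h) - k x) <= C * Rabs h ^ 2 * Rabs (x + h - x)).
  { apply bounded_variation with (dh := fun u => f1 u - f1 x - (u - x) * f2 x).
    rewrite Exh. intros t Ht. split.
    - destruct (H t Ht) as [Hf _].
      evar_last.
      { apply (is_derive_minus (V := R_NormedModule)).
        - apply (is_derive_minus (V := R_NormedModule)); [exact Hf|].
          instantiate (1 := f1 x). auto_derive; [auto | ring].
        - instantiate (1 := (t - x) * f2 x). auto_derive; [auto | field]. }
      unfold minus, plus, opp; simpl. as_reals. ring.
    - assert (T2 := taylor2 f1 f2 f3 C x (t - x)).
      replace (x + (t - x)) with t in T2 by ring.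
      apply Rle_trans with (C * (t - x) ^ 2).
      + apply T2. intros u Hu. destruct (H u) as [_ H']; [lra | exact H'].
      + destruct (H t Ht) as [_ [_ [_ HC]]].
        apply Rmult_le_compat_l; [generalize (Rabs_pos (f3 t)); lra|].
        rewrite <- (pow2_abs (t - x)). apply pow_incr. generalize (Rabs_pos (t - x)); lra. }
  rewrite Exh in B. unfold k in B. rewrite Exh in B.
  replace (f (x + h) - f x - h * f1 x - h ^ 2 / 2 * f2 x) with
    (f (x + h) - (x + h) * f1 x - h ^ 2 / 2 * f2 x
     - (f x - x * f1 x - (x - x) ^ 2 / 2 * f2 x)) by (simpl; field).
  replace (C * Rabs h ^ 3) with (C * Rabs h ^ 2 * Rabs h) by ring. exact B.
Qed.

Definition approx (rho : R) (n : nat) (t : R) : R :=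
  / rho * eval ray_P0 (INR n / rho) (t / rho)
  + / rho ^ 2 * eval ray_P1 (INR n / rho) (t / rho).

Definition approx_dt (rho : R) (n : nat) (t : R) : R :=
  / rho ^ 2 * eval (ray_dT ray_P0) (INR n / rho) (t / rho)
  + / rho ^ 3 * eval (ray_dT ray_P1) (INR n / rho) (t / rho).

Lemma approx_derive rho n t : 0 < rho -> (0 < n)%nat -> 0 < t ->
  is_derive (approx rho n) t (approx_dt rho n t).
Proof.
  intros Hr Hn Ht.
  assert (HN : 0 < INR n / rho) by (apply Rdiv_lt_0_compat; [now apply lt_0_INR | lra]).
  assert (HT : 0 < t / rho) by (now apply Rdiv_lt_0_compat).
  assert (D : forall e, is_derive (fun t => eval e (INR n / rho) (t / rho)) t
                (/ rho * eval (ray_dT e) (INR n / rho) (t / rho))).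
  { intros e. apply (is_derive_comp (fun T => eval e (INR n / rho) T) (fun t => t / rho)).
    - now apply eval_dT.
    - auto_derive; [auto | field; lra]. }
  unfold approx, approx_dt. evar_last.
  { apply (is_derive_plus (V := R_NormedModule)); apply is_derive_scal; apply D. }
  change plus with Rplus. as_reals. generalize (eval (ray_dT ray_P0) (INR n / rho) (t / rho)) (eval (ray_dT ray_P1) (INR n / rho) (t / rho)).
  intros. field. lra.
Qed.

Lemma approx_right_continuous0 rho n : 0 < rho -> (0 < n)%nat ->
  right_continuous0 (approx rho n).
Proof.
  intros Hr Hn.
  assert (HN : 0 < INR n / rho) by (apply Rdiv_lt_0_compat; [now apply lt_0_INR | lra]).
  assert (D : forall e, right_continuous0 (fun t => eval e (INR n / rho) (t / rho))).
  { intros e. assert (He := eval_right_continuous0 e _ HN).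
    unfold right_continuous0 in *. unfold Rdiv at 4. rewrite Rmult_0_l.
    apply (filterlim_comp _ _ _ (fun t => t / rho) (fun T => eval e (INR n / rho) T)
             (at_right 0) (at_right 0)); [|exact He].
    intros P [eps HP].
    assert (Hd : 0 < rho * eps) by (apply Rmult_lt_0_compat; [lra | apply cond_pos]).
    exists (mkposreal _ Hd). intros t Ht Ht0. apply HP.
    - change (Rabs (t / rho - 0) < eps). change (Rabs (t - 0) < rho * eps) in Ht.
      rewrite Rminus_0_r in *.
      rewrite Rabs_pos_eq in * by (try apply Rdiv_le_0_compat; lra).
      apply Rlt_div_l; lra.
    - now apply Rdiv_lt_0_compat. }
  unfold approx. apply right_continuous0_plus; apply right_continuous0_scal; apply D.
Qed.

Lemma approx_bounded d Tm : 0 < d <= 1 -> 0 <= Tm ->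
  exists C, 0 <= C /\ forall rho n t, 1 <= rho -> d * rho <= INR n ->
    0 <= t <= Tm * rho -> Rabs (approx rho n t) <= C.
Proof.
  intros Hd HTm.
  destruct (eval_bounded ray_P0 d Tm Hd HTm) as [C0 [PC0 B0]].
  destruct (eval_bounded ray_P1 d Tm Hd HTm) as [C1 [PC1 B1]].
  exists (C0 + C1). split; [lra|]. intros rho n t Hr Hn Ht.
  assert (HN : d <= INR n / rho) by (apply Rle_div_r; lra).
  assert (HT : 0 <= t / rho <= Tm).
  { split; [apply Rdiv_le_0_compat; lra | apply Rle_div_l; lra]. }
  unfold approx. eapply Rle_trans; [apply Rabs_triang|].
  rewrite !Rabs_mult.
  specialize (B0 _ _ HN HT). specialize (B1 _ _ HN HT).
  assert (Hi : 0 < / rho <= 1).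
  { split; [apply Rinv_0_lt_compat; lra|]. rewrite <- Rinv_1. apply Rinv_le_contravar; lra. }
  assert (I0 : Rabs (/ rho) <= 1) by (rewrite Rabs_pos_eq; lra).
  assert (I1 : Rabs (/ rho ^ 2) <= 1).
  { rewrite <- pow_inv, <- RPow_abs, Rabs_pos_eq by lra.
    rewrite <- (pow1 2). apply pow_incr; lra. }
  generalize (Rabs_pos (eval ray_P0 (INR n / rho) (t / rho)))
    (Rabs_pos (eval ray_P1 (INR n / rho) (t / rho))). nra.
Qed.

(** The error of [/ n - / n ^ 2] as an approximation of [/ (n + 1)] is exactly
    [/ (n ^ 2 * (n + 1))]. *)
Lemma approx_init rho n d : 0 < rho -> 0 < d -> d * rho <= INR n ->
  Rabs (/ (INR n + 1) - approx rho n 0) <= / d ^ 3 * / rho ^ 3.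
Proof.
  intros Hr Hd Hn. assert (Hn0 : 0 < INR n) by nra.
  assert (HN : 0 < INR n / rho) by (apply Rdiv_lt_0_compat; lra).
  destruct (eval_init _ HN) as [E0 E1].
  unfold approx. replace (0 / rho) with 0 by (field; lra). rewrite E0, E1.
  replace (/ (INR n + 1) - (/ rho * / (INR n / rho) + / rho ^ 2 * - / (INR n / rho) ^ 2))
    with (/ (INR n ^ 2 * (INR n + 1))) by (field; lra).
  rewrite Rabs_pos_eq by (left; apply Rinv_0_lt_compat; apply Rmult_lt_0_compat; nra).
  rewrite <- Rinv_mult. apply Rinv_le_contravar.
  - apply Rmult_lt_0_compat; apply pow_lt; lra.
  - replace (d ^ 3 * rho ^ 3) with ((d * rho) ^ 3) by ring.
    apply Rle_trans with (INR n ^ 3); [apply pow_incr; nra | simpl; nra].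
Qed.

Lemma eval_taylor3 e d Tm : 0 < d <= 1 -> 0 <= Tm ->
  exists C, 0 <= C /\ forall N h T, d <= N - Rabs h -> 0 <= T <= Tm ->
    Rabs (eval e (N + h) T - eval e N T - h * eval (ray_dN e) N T
          - h ^ 2 / 2 * eval (ray_dN (ray_dN e)) N T) <= C * Rabs h ^ 3.
Proof.
  intros Hd HTm.
  destruct (eval_bounded (ray_dN (ray_dN (ray_dN e))) d Tm Hd HTm) as [C [PC B]].
  exists C. split; [exact PC|]. intros N h T HN HT.
  apply (taylor3 (fun N => eval e N T) (fun N => eval (ray_dN e) N T)
     (fun N => eval (ray_dN (ray_dN e)) N T)
     (fun N => eval (ray_dN (ray_dN (ray_dN e))) N T)).
  intros u Hu. apply Rabs_le_between in Hu.
  assert (Hu' : d <= u) by lra.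
  repeat split; try (apply eval_dN; lra). now apply B.
Qed.

Lemma eval_taylor2 e d Tm : 0 < d <= 1 -> 0 <= Tm ->
  exists C, 0 <= C /\ forall N h T, d <= N - Rabs h -> 0 <= T <= Tm ->
    Rabs (eval e (N + h) T - eval e N T - h * eval (ray_dN e) N T) <= C * h ^ 2.
Proof.
  intros Hd HTm.
  destruct (eval_bounded (ray_dN (ray_dN e)) d Tm Hd HTm) as [C [PC B]].
  exists C. split; [exact PC|]. intros N h T HN HT.
  apply (taylor2 (fun N => eval e N T) (fun N => eval (ray_dN e) N T)
     (fun N => eval (ray_dN (ray_dN e)) N T)).
  intros u Hu. apply Rabs_le_between in Hu.
  assert (Hu' : d <= u) by lra.
  repeat split; try (apply eval_dN; lra). now apply B.
Qed.

(** Multiplied by [n + 1 = rho * (N + / rho)], the residual is a combination of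
    Taylor remainders and of [/ rho ^ 4 * dP1/dT]: the two transport equations
    cancel everything else.  Two terms suffice for an error of order [/ rho ^ 3]
    because a residual of order [/ rho ^ 4] acts during a time of order [rho]. *)
Lemma approx_residual d Tm : 0 < d <= 1 -> 0 <= Tm ->
  exists C, 0 <= C /\ forall rho n t, 1 <= rho -> d * rho + 1 <= INR n ->
    0 <= t <= Tm * rho ->
    Rabs (approx_dt rho n t - ps_generator rho (fun k => approx rho k t) n)
    <= C * / rho ^ 4.
Proof.
  intros Hd HTm.
  destruct (eval_taylor3 ray_P0 d Tm Hd HTm) as [C0 [PC0 B0]].
  destruct (eval_taylor2 ray_P1 d Tm Hd HTm) as [C1 [PC1 B1]].
  destruct (eval_bounded (ray_dT ray_P1) d Tm Hd HTm) as [C2 [PC2 B2]].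
  exists ((C0 + C1) + (C0 + C1 + C2) / d). split.
  { assert (0 <= (C0 + C1 + C2) / d) by (apply Rdiv_le_0_compat; lra). lra. }
  intros rho n t Hr Hn Ht.
  set (N := INR n / rho). set (T := t / rho). set (e := / rho).
  assert (He : 0 < e <= 1).
  { unfold e. split; [apply Rinv_0_lt_compat; lra|].
    rewrite <- Rinv_1. apply Rinv_le_contravar; lra. }
  assert (HN : d <= N - e).
  { unfold N, e. replace (INR n / rho - / rho) with ((INR n - 1) / rho) by (field; lra).
    apply Rle_div_r; lra. }
  assert (HT : 0 <= T <= Tm).
  { unfold T. split; [apply Rdiv_le_0_compat; lra | apply Rle_div_l; lra]. }
  assert (En : INR n = N * rho) by (unfold N; field; lra).
  assert (Er : rho = / e) by (unfold e; now rewrite Rinv_inv).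
  assert (Hn1 : (1 <= n)%nat).
  { apply INR_le. simpl. nra. }
  assert (Am : approx rho (Nat.pred n) t
      = e * eval ray_P0 (N + - e) T + e ^ 2 * eval ray_P1 (N + - e) T).
  { unfold approx. replace (INR (Nat.pred n) / rho) with (N + - e).
    - fold T e. rewrite <- pow_inv. fold e. reflexivity.
    - rewrite <- Nat.sub_1_r, minus_INR by exact Hn1. simpl. unfold N, e. field. lra. }
  assert (Ap : approx rho (S n) t
      = e * eval ray_P0 (N + e) T + e ^ 2 * eval ray_P1 (N + e) T).
  { unfold approx. replace (INR (S n) / rho) with (N + e).
    - fold T e. rewrite <- pow_inv. fold e. reflexivity.
    - rewrite S_INR. unfold N, e. field. lra. }
  assert (A0 : approx rho n t = e * eval ray_P0 N T + e ^ 2 * eval ray_P1 N T).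
  { unfold approx. fold N T e. rewrite <- pow_inv. reflexivity. }
  assert (Ad : approx_dt rho n t
      = e ^ 2 * eval (ray_dT ray_P0) N T + e ^ 3 * eval (ray_dT ray_P1) N T).
  { unfold approx_dt. fold N T e. rewrite <- !pow_inv. reflexivity. }
  unfold ps_generator, generator, ps_down, ps_up, ps_total.
  rewrite Am, Ap, A0, Ad, En.
  assert (Ra : Rabs e = e) by (apply Rabs_pos_eq; lra).
  assert (Rb : Rabs (- e) = e) by (rewrite Rabs_Ropp; exact Ra).
  assert (R0m := B0 N (- e) T ltac:(lra) HT). assert (R0p := B0 N e T ltac:(lra) HT).
  assert (R1m := B1 N (- e) T ltac:(lra) HT). assert (R1p := B1 N e T ltac:(lra) HT).
  assert (R2 := B2 N T ltac:(lra) HT).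
  rewrite Rb in R0m. rewrite Ra in R0p.
  assert (T0 := transport_P0 N T ltac:(lra) (proj1 HT)).
  assert (T1 := transport_P1 N T ltac:(lra) (proj1 HT)).
  set (r0m := eval ray_P0 (N + - e) T - eval ray_P0 N T
     - - e * eval (ray_dN ray_P0) N T
     - (- e) ^ 2 / 2 * eval (ray_dN (ray_dN ray_P0)) N T) in *.
  set (r0p := eval ray_P0 (N + e) T - eval ray_P0 N T
     - e * eval (ray_dN ray_P0) N T
     - e ^ 2 / 2 * eval (ray_dN (ray_dN ray_P0)) N T) in *.
  set (r1m := eval ray_P1 (N + - e) T - eval ray_P1 N T
     - - e * eval (ray_dN ray_P1) N T) in *.
  set (r1p := eval ray_P1 (N + e) T - eval ray_P1 N T
     - e * eval (ray_dN ray_P1) N T) in *.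
  assert (F0m : eval ray_P0 (N + - e) T = r0m + eval ray_P0 N T
     - e * eval (ray_dN ray_P0) N T
     + e ^ 2 / 2 * eval (ray_dN (ray_dN ray_P0)) N T) by (unfold r0m; field).
  assert (F0p : eval ray_P0 (N + e) T = r0p + eval ray_P0 N T
     + e * eval (ray_dN ray_P0) N T
     + e ^ 2 / 2 * eval (ray_dN (ray_dN ray_P0)) N T) by (unfold r0p; field).
  assert (F1m : eval ray_P1 (N + - e) T = r1m + eval ray_P1 N T
     - e * eval (ray_dN ray_P1) N T) by (unfold r1m; ring).
  assert (F1p : eval ray_P1 (N + e) T = r1p + eval ray_P1 N T
     + e * eval (ray_dN ray_P1) N T) by (unfold r1p; ring).
  rewrite F0m, F0p, F1m, F1p.
  clearbody r0m r0p r1m r1p.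
  revert T0 T1 R2.
  generalize (eval (ray_dN (ray_dN ray_P0)) N T) (eval (ray_dN ray_P0) N T)
    (eval (ray_dN ray_P1) N T) (eval ray_P0 N T) (eval ray_P1 N T)
    (eval (ray_dT ray_P0) N T) (eval (ray_dT ray_P1) N T).
  intros d2P0 d1P0 d1P1 vP0 vP1 tP0 tP1 T0 T1 R2.
  match goal with |- Rabs ?x <= _ =>
    replace x with (- (e * r0m + e ^ 2 * r1m) * (N / (N + e))
      + (e ^ 4 * tP1 - (e * r0p + e ^ 2 * r1p)) / (N + e)) end.
  2:{ assert (Q1 : d2P0 = 2 * (tP0 + N * tP1 - (1 - N) * d1P1 + vP1) / (N + 1))
        by (field_simplify_eq; lra).
      assert (Q0 : vP0 = (1 - N) * d1P0 - N * tP0) by lra.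
      rewrite Q1, Q0, Er. field. repeat split; nra. }
  assert (HNe : 0 <= N / (N + e) <= 1).
  { split; [apply Rdiv_le_0_compat; lra | apply Rle_div_l; lra]. }
  assert (Re : / rho ^ 4 = e ^ 4) by (unfold e; now rewrite pow_inv).
  rewrite Re.
  apply Rabs_le_between in R0m, R0p, R1m, R1p, R2.
  assert (P2 : 0 < e ^ 2) by (apply pow_lt; lra).
  assert (P4 : 0 < e ^ 4) by (apply pow_lt; lra).
  assert (X1 : Rabs (e * r0m + e ^ 2 * r1m) <= (C0 + C1) * e ^ 4).
  { apply Rabs_le. replace ((- e) ^ 2) with (e ^ 2) in R1m by ring.
    split; nra. }
  assert (X2 : Rabs (e ^ 4 * tP1 - (e * r0p + e ^ 2 * r1p)) <= (C0 + C1 + C2) * e ^ 4).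
  { apply Rabs_le. split; nra. }
  eapply Rle_trans; [apply Rabs_triang|].
  rewrite Rmult_plus_distr_r. apply Rplus_le_compat.
  - rewrite Rabs_mult, Rabs_Ropp, (Rabs_pos_eq (N / (N + e))) by lra.
    generalize (Rabs_pos (e * r0m + e ^ 2 * r1m)). nra.
  - rewrite Rabs_div, (Rabs_pos_eq (N + e)) by lra.
    replace ((C0 + C1 + C2) / d * e ^ 4) with ((C0 + C1 + C2) * e ^ 4 / d) by (field; lra).
    unfold Rdiv. apply Rmult_le_compat.
    + apply Rabs_pos.
    + left; apply Rinv_0_lt_compat; lra.
    + exact X2.
    + apply Rinv_le_contravar; lra.
Qed.

Lemma exp_neg_le_pow4 c rho x : 0 < c -> 0 < rho -> c * rho <= x ->
  exp (- x) <= 256 / c ^ 4 * / rho ^ 4.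
Proof.
  intros Hc Hr Hx.
  assert (H0 : 0 < c * rho) by (now apply Rmult_lt_0_compat).
  replace (256 / c ^ 4 * / rho ^ 4) with (/ (c * rho / 4) ^ 4) by (field; lra).
  rewrite exp_Ropp. apply Rinv_le_contravar; [apply pow_lt; lra|].
  replace x with (x / 4 + x / 4 + x / 4 + x / 4) by field. rewrite !exp_plus.
  replace (exp (x / 4) * exp (x / 4) * exp (x / 4) * exp (x / 4))
    with (exp (x / 4) ^ 4) by ring.
  apply pow_incr. generalize (exp_ineq1_le (x / 4)). lra.
Qed.

(** A barrier against the small queue lengths, where the expansion breaks down.
    Below [rho / 3] the upward drift makes this exponential a supersolution, since
    [exp 1 <= 3]; above, where it will be exponentially small, the crude bound
    is enough. *)
Lemma barrier_generator rho x n : 0 < rho -> (0 < n)%nat ->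
  ps_generator rho (fun j => exp (x - INR j)) n <= 2 * exp (x - INR n) /\
  (INR n <= rho / 3 -> ps_generator rho (fun j => exp (x - INR j)) n <= 0).
Proof.
  intros Hr Hn.
  assert (Hn1 : 1 <= INR n) by (change 1 with (INR 1); apply le_INR; lia).
  assert (He3 := exp_le_3). assert (He2 := exp_ineq1 1 ltac:(lra)).
  set (B := exp (x - INR n)). assert (HB : 0 < B) by apply exp_pos.
  assert (Bm : exp (x - INR (Nat.pred n)) = exp 1 * B).
  { unfold B. rewrite <- exp_plus. f_equal.
    rewrite <- Nat.sub_1_r, minus_INR by lia. simpl. ring. }
  assert (Bp : exp (x - INR (S n)) = / exp 1 * B).
  { unfold B. rewrite <- exp_Ropp, <- exp_plus. f_equal. rewrite S_INR. ring. }
  assert (E : ps_generator rho (fun j => exp (x - INR j)) n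
     = B / (INR n + 1) * ((exp 1 - 1) / exp 1 * (INR n * exp 1 - rho) - 1)).
  { unfold ps_generator, generator, ps_down, ps_up, ps_total. rewrite Bm, Bp.
    fold B. field. lra. }
  rewrite E.
  assert (HBn : 0 < B / (INR n + 1)) by (apply Rdiv_lt_0_compat; lra).
  assert (Hq : 0 < (exp 1 - 1) / exp 1) by (apply Rdiv_lt_0_compat; lra).
  split.
  - assert ((exp 1 - 1) / exp 1 * (INR n * exp 1 - rho) - 1 <= 2 * INR n).
    { apply Rle_trans with ((exp 1 - 1) / exp 1 * (INR n * exp 1)); [nra|].
      replace ((exp 1 - 1) / exp 1 * (INR n * exp 1)) with ((exp 1 - 1) * INR n)
        by (field; lra). nra. }
    apply Rle_trans with (B / (INR n + 1) * (2 * (INR n + 1))); [nra|].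
    right. field. lra.
  - intros H.
    assert (INR n * exp 1 <= INR n * 3) by (apply Rmult_le_compat_l; lra).
    assert ((exp 1 - 1) / exp 1 * (INR n * exp 1 - rho) <= 0) by nra. nra.
Qed.

Lemma generator_minus a b c u v n :
  generator a b c (fun k => u k - v k) n = generator a b c u n - generator a b c v n.
Proof. unfold generator. ring. Qed.

(** The comparison runs on [n > k] with [k] of order [d * rho], away from the
    singularity of the expansion at [N = 0].  At [n = k] the error is only known to
    be bounded; the barrier makes this contribution exponentially small at
    [n = N * rho].  The initial error and the accumulated residual are both of
    order [/ rho ^ 3]. *)
Lemma density_expansion (V : R -> nat -> R -> R) :
  (forall rho, 0 < rho -> is_sojourn_tail rho (V rho)) ->
  forall N T, 0 < N -> 0 < T ->
  exists C rho0 : R, forall (rho : R) (n : nat),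
    0 < rho -> rho0 < rho -> INR n = N * rho ->
    Rabs (density rho (V rho) n (T * rho) - approx rho n (T * rho)) <= C * / rho ^ 3.
Proof.
  intros HV N T HN HT. assert (HT' := Rlt_le _ _ HT).
  (* The factor 8 keeps k <= 2 * d * rho well below both N * rho and rho / 3. *)
  set (d := Rmin N 1 / 8).
  assert (Hd : 0 < d <= 1 /\ 8 * d <= N /\ 8 * d <= 1).
  { unfold d. generalize (Rmin_pos_1 N HN) (Rmin_l N 1) (Rmin_r N 1). lra. }
  destruct Hd as [Hd [HdN Hd1]].
  destruct (approx_bounded d T Hd HT') as [CA [PCA BA]].
  destruct (approx_residual d T Hd HT') as [CR [PCR BR]].
  set (K := 1 + CA). set (CB := 512 * 12 ^ 4).
  assert (PK : 1 <= K) by (unfold K; lra).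
  assert (PCB : 0 <= CB) by (unfold CB; lra).
  assert (PI : 0 <= / d ^ 3) by (left; apply Rinv_0_lt_compat, pow_lt; lra).
  exists (/ d ^ 3 + (CR + K * CB) * T + K * (256 / (N / 2) ^ 4)), (Rmax 1 (/ d)).
  intros rho n Hr Hr0 Hn.
  assert (Hr1 : 1 <= rho) by (generalize (Rmax_l 1 (/ d)); lra).
  assert (Hdr : 1 <= d * rho).
  { generalize (Rmax_r 1 (/ d)). intros.
    replace 1 with (d * / d) by (field; lra). apply Rmult_le_compat_l; lra. }
  destruct (nfloor_ex (d * rho) ltac:(lra)) as [k' [Hk1 Hk2]].
  set (k := S k').
  assert (Hk : d * rho <= INR k <= 2 * (d * rho)) by (unfold k; rewrite S_INR; lra).
  set (w := fun (j : nat) (t : R) => / d ^ 3 * / rho ^ 3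
     + (CR + K * CB) * / rho ^ 4 * t + K * exp (INR k - INR j)).
  assert (P3 : 0 < / rho ^ 3) by (apply Rinv_0_lt_compat, pow_lt; lra).
  assert (P4 : 0 < / rho ^ 4) by (apply Rinv_0_lt_compat, pow_lt; lra).
  assert (PKB : 0 <= CR + K * CB) by nra.
  assert (PP : 0 <= (CR + K * CB) * / rho ^ 4) by (apply Rmult_le_pos; lra).
  assert (Pw : forall t, 0 <= t ->
     0 <= / d ^ 3 * / rho ^ 3 + (CR + K * CB) * / rho ^ 4 * t).
  { intros t Ht. apply Rplus_le_le_0_compat; apply Rmult_le_pos; lra. }
  assert (Hdom : Rabs (density rho (V rho) n (T * rho) - approx rho n (T * rho))
                 <= w n (T * rho)).
  { apply (domination (S k) (1 + rho) (T * rho) K _ _ _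
      (fun j t => density rho (V rho) j t - approx rho j t)
      (fun j t => ps_generator rho (fun i => density rho (V rho) i t) j - approx_dt rho j t)
      w (fun _ _ => (CR + K * CB) * / rho ^ 4)
      ltac:(nra) (ps_rates rho (S k) Hr)).
    - intros j t Hj Ht. simpl in Hj. apply le_INR in Hj.
      assert (A := BA rho j t Hr1 ltac:(lra) ltac:(lra)).
      assert (D0 := density_nonneg rho (V rho) Hr (HV rho Hr) j t (proj1 Ht)).
      assert (D1 := density_le_1 rho (V rho) Hr (HV rho Hr) j t (proj1 Ht)).
      apply Rabs_le_between in A. apply Rabs_le. unfold K. lra.
    - intros j t _ Ht. unfold w. generalize (Pw t (proj1 Ht)) (exp_pos (INR k - INR j)). nra.
    - intros t _ Ht. simpl Nat.pred.
      assert (A := BA rho k t Hr1 ltac:(lra) ltac:(lra)).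
      assert (D0 := density_nonneg rho (V rho) Hr (HV rho Hr) k t (proj1 Ht)).
      assert (D1 := density_le_1 rho (V rho) Hr (HV rho Hr) k t (proj1 Ht)).
      apply Rabs_le_between in A.
      apply Rle_trans with K; [apply Rabs_le; unfold K; lra|].
      unfold w. rewrite Rminus_diag, exp_0. generalize (Pw t (proj1 Ht)). lra.
    - intros j Hj. assert (Hj' : (k <= j)%nat) by lia. apply le_INR in Hj'.
      rewrite density_init by (apply HV; lra).
      eapply Rle_trans; [apply (approx_init rho j d); lra|].
      unfold w. generalize (exp_pos (INR k - INR j)). nra.
    - intros j Hj. apply right_continuous0_minus.
      + apply density_right_continuous0; auto.
      + apply approx_right_continuous0; [lra | lia].
    - intros j Hj. apply continuous_right_continuous0.
      apply (ex_derive_continuous (V := R_NormedModule)). unfold w. auto_derive. auto.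
    - intros j t Hj Ht. apply (is_derive_minus (V := R_NormedModule)).
      + apply density_ode; [auto | lra].
      + apply approx_derive; [lra | lia | lra].
    - intros j t Hj Ht. unfold w. auto_derive; [auto |]. change (rho * (rho * (rho * (rho * 1)))) with (rho ^ 4). ring.
    - intros j t Hj Ht. rewrite generator_minus.
      fold (ps_generator rho).
      match goal with |- Rabs ?x <= _ =>
        replace x with (- (approx_dt rho j t - ps_generator rho (fun i => approx rho i t) j))
          by ring end.
      rewrite Rabs_Ropp.
      assert (Hjk : INR k + 1 <= INR j) by (rewrite <- S_INR; now apply le_INR).
      eapply Rle_trans; [apply (BR rho j t Hr1); lra|].
      assert (Ew : ps_generator rho (fun i => w i t) j =
         - ((/ d ^ 3 * / rho ^ 3 + (CR + K * CB) * / rho ^ 4 * t) / (INR j + 1))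
         + K * ps_generator rho (fun i => exp (INR k - INR i)) j).
      { rewrite <- ps_generator_const with (rho := rho).
        unfold w, ps_generator, generator. ring. }
      rewrite Ew.
      assert (0 <= (/ d ^ 3 * / rho ^ 3 + (CR + K * CB) * / rho ^ 4 * t) / (INR j + 1)).
      { apply Rdiv_le_0_compat; [apply Pw; lra | generalize (pos_INR j); lra]. }
      assert (GB : ps_generator rho (fun i => exp (INR k - INR i)) j <= CB * / rho ^ 4).
      { destruct (barrier_generator rho (INR k) j Hr ltac:(lia)) as [G1 G2].
        destruct (Rle_dec (INR j) (rho / 3)) as [h|h].
        - eapply Rle_trans; [now apply G2|]. apply Rmult_le_pos; lra.
        - eapply Rle_trans; [exact G1|].
          replace (INR k - INR j) with (- (INR j - INR k)) by ring.
          assert (X := exp_neg_le_pow4 (1 / 12) rho (INR j - INR k) ltac:(lra) Hr).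
          assert (CB * / rho ^ 4 = 2 * (256 / (1 / 12) ^ 4 * / rho ^ 4)).
          { unfold CB. field. lra. }
          assert (1 / 12 * rho <= INR j - INR k) by nra.
          specialize (X H1). lra. }
      nra.
    - simpl. apply INR_le. nra.
    - nra. }
  eapply Rle_trans; [exact Hdom|]. unfold w.
  replace (INR k - INR n) with (- (INR n - INR k)) by ring.
  assert (X := exp_neg_le_pow4 (N / 2) rho (INR n - INR k) ltac:(lra) Hr ltac:(nra)).
  assert (P34 : / rho ^ 4 <= / rho ^ 3).
  { apply Rinv_le_contravar; [apply pow_lt; lra|]. apply Rle_pow; [lra | lia]. }
  assert (E4 : (CR + K * CB) * / rho ^ 4 * (T * rho) = (CR + K * CB) * T * / rho ^ 3)
    by (field; lra).
  rewrite E4.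
  assert (PN : 0 <= 256 / (N / 2) ^ 4).
  { apply Rdiv_le_0_compat; [lra | apply pow_lt; lra]. }
  assert (exp (- (INR n - INR k)) <= 256 / (N / 2) ^ 4 * / rho ^ 3).
  { eapply Rle_trans; [exact X|]. apply Rmult_le_compat_l; lra. }
  nra.
Qed.

(** * The Bessel function of the square root *)

Definition bessel_coef (k : nat) : R := (-1) ^ k / INR (fact k) ^ 2.

(** [bessel x = J0 (2 * sqrt x)] for [0 <= x], an entire function. *)
Definition bessel : R -> R := PSeries bessel_coef.
Definition bessel1 : R -> R := PSeries (PS_derive bessel_coef).
Definition bessel2 : R -> R := PSeries (PS_derive (PS_derive bessel_coef)).

Lemma J0_bessel x : J0 x = bessel ((x / 2) ^ 2).
Proof.
  unfold J0, bessel, PSeries, bessel_coef. apply Series_ext. intros k.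
  now rewrite pow_mult.
Qed.

Lemma bessel_coef_S k :
  (INR k + 1) * ((INR k + 1) * bessel_coef (S k)) = - bessel_coef k.
Proof.
  unfold bessel_coef. rewrite fact_simpl, mult_INR, S_INR. simpl pow.
  generalize (pos_INR k) (INR_fact_neq_0 k). intros. field. split; [assumption | lra].
Qed.

Lemma bessel_radius : CV_radius bessel_coef = p_infty.
Proof.
  apply CV_radius_infinite_DAlembert.
  - intros k. unfold bessel_coef, Rdiv.
    apply Rmult_integral_contrapositive_currified.
    + apply pow_nonzero; lra.
    + apply Rinv_neq_0_compat, pow_nonzero, INR_fact_neq_0.
  - apply is_lim_seq_le_le with (u := fun _ => 0) (w := fun k => / (INR k + 1)).
    + intros k. split; [apply Rabs_pos|].
      assert (Hk := pos_INR k).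
      assert (N : bessel_coef k <> 0).
      { unfold bessel_coef, Rdiv. apply Rmult_integral_contrapositive_currified.
        - apply pow_nonzero; lra.
        - apply Rinv_neq_0_compat, pow_nonzero, INR_fact_neq_0. }
      replace (bessel_coef (S k) / bessel_coef k) with (- (/ (INR k + 1) * / (INR k + 1))).
      * rewrite Rabs_Ropp, Rabs_pos_eq.
        -- assert (0 < / (INR k + 1) <= 1).
           { split; [apply Rinv_0_lt_compat; lra|].
             rewrite <- Rinv_1. apply Rinv_le_contravar; lra. }
           nra.
        -- apply Rmult_le_pos; left; apply Rinv_0_lt_compat; lra.
      * generalize (bessel_coef_S k). intros E.
        apply (Rmult_eq_reg_r (bessel_coef k)); [|exact N].
        unfold Rdiv. rewrite (Rmult_assoc (bessel_coef (S k))), Rinv_l by exact N.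
        replace (bessel_coef k) with (- ((INR k + 1) * ((INR k + 1) * bessel_coef (S k)))) by lra.
        field. lra.
    + apply is_lim_seq_const.
    + apply is_lim_seq_inv with (l := p_infty); [|discriminate].
      apply is_lim_seq_ext with (fun k => INR (S k)).
      * intros; apply S_INR.
      * apply (is_lim_seq_incr_1 INR). apply is_lim_seq_INR.
Qed.

Lemma bessel_derive x : is_derive bessel x (bessel1 x).
Proof. apply is_derive_PSeries. rewrite bessel_radius. exact I. Qed.

Lemma bessel1_derive x : is_derive bessel1 x (bessel2 x).
Proof. apply is_derive_PSeries. rewrite CV_radius_derive, bessel_radius. exact I. Qed.

(** The recursion [bessel_coef_S] in terms of functions. *)
Lemma bessel1_scaled_derive x : is_derive (fun x => x * bessel1 x) x (- bessel x).
Proof.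
  apply is_derive_ext with (PSeries (PS_incr_1 (PS_derive bessel_coef))).
  { intros t. apply PSeries_incr_1. }
  evar_last.
  { apply is_derive_PSeries. rewrite CV_radius_incr_1, CV_radius_derive, bessel_radius. exact I. }
  unfold bessel. rewrite <- PSeries_opp. apply PSeries_ext. intros k.
  unfold PS_derive, PS_incr_1, PS_opp, opp. simpl Hierarchy.opp.
  rewrite S_INR. exact (bessel_coef_S k).
Qed.

Lemma bessel_ode x : x * bessel2 x + bessel1 x + bessel x = 0.
Proof.
  assert (H : is_derive (fun x => x * bessel1 x) x (1 * bessel1 x + x * bessel2 x)).
  { apply (is_derive_mult (fun x => x) bessel1).
    - apply (is_derive_id (K := R_AbsRing)).
    - apply bessel1_derive.
    - intros; apply Rmult_comm. }
  generalize (is_derive_unique _ _ _ H) (is_derive_unique _ _ _ (bessel1_scaled_derive x)).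
  lra.
Qed.

Lemma bessel_0 : bessel 0 = 1.
Proof. unfold bessel. rewrite PSeries_0. unfold bessel_coef. simpl. field. Qed.

Lemma bessel1_0 : bessel1 0 = - 1.
Proof. unfold bessel1. rewrite PSeries_0. unfold PS_derive, bessel_coef. simpl. field. Qed.

(** The energy [bessel x ^ 2 + x * bessel1 x ^ 2] equals [1] at the origin and has
    derivative [- bessel1 x ^ 2] by the differential equation. *)
Lemma bessel_bounded x : 0 <= x -> Rabs (bessel x) <= 1.
Proof.
  intros Hx.
  assert (E : - (bessel 0 ^ 2 + 0 * bessel1 0 ^ 2) <= - (bessel x ^ 2 + x * bessel1 x ^ 2)).
  { apply derive_nonneg_incr with
      (h := fun x => - (bessel x ^ 2 + x * bessel1 x ^ 2)) (h' := fun x => bessel1 x ^ 2).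
    - exact Hx.
    - intros u Hu. auto_derive.
      + split; [eexists; apply bessel_derive|].
        split; [eexists; apply bessel1_derive|]. auto.
      + replace (Derive (fun x => bessel x) u) with (bessel1 u)
          by (symmetry; apply is_derive_unique, bessel_derive).
        replace (Derive (fun x => bessel1 x) u) with (bessel2 u)
          by (symmetry; apply is_derive_unique, bessel1_derive).
        generalize (bessel_ode u). intros O.
        replace (bessel u) with (- (u * bessel2 u + bessel1 u)) by lra. ring.
    - intros u _. apply pow2_ge_0. }
  rewrite bessel_0 in E.
  assert (0 <= x * bessel1 x ^ 2) by (apply Rmult_le_pos; [lra | apply pow2_ge_0]).
  apply Rabs_le. nra.
Qed.

(** [x * bessel1 x] is minus the integral of [bessel] from [0] to [x]. *)
Lemma bessel1_bounded x : 0 <= x -> Rabs (bessel1 x) <= 1.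
Proof.
  intros Hx. destruct (Req_dec x 0) as [->|Hne].
  { apply Rabs_le. rewrite bessel1_0. lra. }
  assert (B : forall u, 0 <= u <= x -> -1 <= bessel u <= 1).
  { intros u Hu. apply Rabs_le_between, bessel_bounded. lra. }
  assert (L : 0 - 0 * bessel1 0 <= x - x * bessel1 x).
  { apply derive_nonneg_incr with (h := fun x => x - x * bessel1 x)
      (h' := fun x => 1 - - bessel x); [lra | |].
    - intros u Hu. apply (is_derive_minus (V := R_NormedModule)).
      + apply (is_derive_id (K := R_AbsRing)).
      + apply bessel1_scaled_derive.
    - intros u Hu. generalize (B u Hu). lra. }
  assert (M : 0 + 0 * bessel1 0 <= x + x * bessel1 x).
  { apply derive_nonneg_incr with (h := fun x => x + x * bessel1 x)
      (h' := fun x => 1 + - bessel x); [lra | |].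
    - intros u Hu. apply (is_derive_plus (V := R_NormedModule)).
      + apply (is_derive_id (K := R_AbsRing)).
      + apply bessel1_scaled_derive.
    - intros u Hu. generalize (B u Hu). lra. }
  apply Rabs_le. split; nra.
Qed.

(** The first term is [sqrt x] times the energy of [bessel_bounded], whose
    derivative oscillates; the other two terms are chosen to make the total
    decreasing. *)
Definition bessel_energy (x : R) : R :=
  sqrt x * (bessel x ^ 2 + x * bessel1 x ^ 2)
  + sqrt x * (bessel x * bessel1 x) / 2 + bessel x ^ 2 / (8 * sqrt x).

Lemma bessel_energy_derive x : 0 < x ->
  is_derive bessel_energy x (- (bessel x ^ 2 / (16 * x * sqrt x))).
Proof.
  intros Hx. assert (Hs := sqrt_lt_R0 x Hx).
  unfold bessel_energy. auto_derive.
  - assert (D0 : ex_derive (fun x => bessel x) x) by (exists (bessel1 x); apply bessel_derive).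
    assert (D1 : ex_derive (fun x => bessel1 x) x) by (exists (bessel2 x); apply bessel1_derive).
    repeat match goal with |- _ /\ _ => split end; try exact I; try assumption; lra.
  - replace (Derive (fun x => bessel x) x) with (bessel1 x)
      by (symmetry; apply is_derive_unique, bessel_derive).
    replace (Derive (fun x => bessel1 x) x) with (bessel2 x)
      by (symmetry; apply is_derive_unique, bessel1_derive).
    replace (bessel2 x) with (- (bessel x + bessel1 x) / x).
    2:{ generalize (bessel_ode x). intros O.
        apply (Rmult_eq_reg_l x); [|lra]. field_simplify; lra. }
    assert (Ex : x = sqrt x * sqrt x) by (symmetry; apply sqrt_sqrt; lra).
    revert Hs Ex. generalize (sqrt x) (bessel x) (bessel1 x).
    intros r b b1 Hs Ex. rewrite Ex. field. lra.
Qed.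

(** For [1 <= x] the decreasing [bessel_energy x] is at least
    [sqrt x * bessel x ^ 2 / 2], whence a decay of order [x] to the power [- 1 / 4]. *)
Lemma bessel_decay eps : 0 < eps ->
  exists X, 0 < X /\ forall x, X <= x -> Rabs (bessel x) < eps.
Proof.
  intros He.
  set (Q := bessel_energy 1).
  assert (B : forall x, 1 <= x -> sqrt x * bessel x ^ 2 <= 2 * Q).
  { intros x Hx.
    assert (M : - Q <= - bessel_energy x).
    { apply derive_nonneg_incr with (h := fun x => - bessel_energy x)
        (h' := fun x => - - (bessel x ^ 2 / (16 * x * sqrt x))); [lra | |].
      - intros u Hu. apply (is_derive_opp (V := R_NormedModule)).
        apply bessel_energy_derive. lra.
      - intros u Hu. rewrite Ropp_involutive.
        assert (Hs := sqrt_lt_R0 u ltac:(lra)).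
        apply Rdiv_le_0_compat; [apply pow2_ge_0 | nra]. }
    assert (Hs := sqrt_lt_R0 x ltac:(lra)).
    unfold bessel_energy in M.
    assert (0 <= bessel x ^ 2 / (8 * sqrt x)).
    { apply Rdiv_le_0_compat; [apply pow2_ge_0 | lra]. }
    assert (0 <= sqrt x * (bessel x ^ 2 / 2 + x * bessel1 x ^ 2 + bessel x * bessel1 x / 2)).
    { apply Rmult_le_pos; [lra|].
      assert (bessel1 x ^ 2 <= x * bessel1 x ^ 2).
      { generalize (pow2_ge_0 (bessel1 x)). nra. }
      generalize (pow2_ge_0 (bessel x + bessel1 x / 2)) (pow2_ge_0 (bessel1 x)). nra. }
    nra. }
  assert (HQ : 0 <= Q).
  { generalize (B 1 (Rle_refl 1)) (pow2_ge_0 (bessel 1)). rewrite sqrt_1. lra. }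
  set (r := 2 * Q / eps ^ 2 + 1).
  assert (He2 : 0 < eps ^ 2) by (apply pow_lt; lra).
  assert (Hr : 1 <= r).
  { unfold r. assert (0 <= 2 * Q / eps ^ 2) by (apply Rdiv_le_0_compat; lra). lra. }
  exists (r ^ 2). split; [apply pow_lt; lra|]. intros x Hx.
  assert (Hrx : r <= sqrt x).
  { rewrite <- (sqrt_pow2 r) by lra. apply sqrt_le_1_alt, Hx. }
  assert (Hx1 : 1 <= x) by nra.
  specialize (B x Hx1).
  assert (r * eps ^ 2 > 2 * Q).
  { unfold r. replace ((2 * Q / eps ^ 2 + 1) * eps ^ 2) with (2 * Q + eps ^ 2) by (field; lra). lra. }
  assert (bessel x ^ 2 < eps ^ 2).
  { generalize (pow2_ge_0 (bessel x)). nra. }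
  apply Rabs_lt_between. split; nra.
Qed.

Definition phi (xi : R) : R := - xi - ln (1 - xi).

Lemma ln_le_sub x : 0 < x -> ln x <= x - 1.
Proof.
  intros Hx. generalize (exp_ineq1_le (ln x)). rewrite exp_ln by lra. lra.
Qed.

Lemma phi_nonneg xi : xi < 1 -> 0 <= phi xi.
Proof. intros H. unfold phi. generalize (ln_le_sub (1 - xi) ltac:(lra)). lra. Qed.

Lemma phi_0 : phi 0 = 0.
Proof. unfold phi. replace (1 - 0) with 1 by ring. rewrite ln_1. ring. Qed.

Lemma phi_derive xi : xi < 1 -> is_derive phi xi (xi / (1 - xi)).
Proof. intros H. unfold phi. auto_derive; [lra | field; lra]. Qed.

Definition kernel (n : nat) (tau xi : R) : R := (1 - xi) ^ n * bessel (tau * phi xi).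

Lemma integrand_kernel n tau xi : 0 <= tau -> xi < 1 ->
  integrand n tau xi = kernel n tau xi.
Proof.
  intros Ht Hx. unfold integrand, kernel. rewrite J0_bessel. fold (phi xi).
  do 2 f_equal.
  replace (2 * sqrt tau * sqrt (phi xi) / 2) with (sqrt tau * sqrt (phi xi)) by field.
  rewrite Rpow_mult_distr, !pow2_sqrt; auto using phi_nonneg.
Qed.

Lemma pow_le_1 x n : 0 <= x <= 1 -> 0 <= x ^ n <= 1.
Proof.
  intros H. split; [apply pow_le; lra|]. rewrite <- (pow1 n). now apply pow_incr.
Qed.

Lemma kernel_bounded n tau xi : 0 <= tau -> 0 <= xi < 1 -> Rabs (kernel n tau xi) <= 1.
Proof.
  intros Ht Hx. unfold kernel. rewrite Rabs_mult.
  generalize (pow_le_1 (1 - xi) n ltac:(lra)). intros Hp.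
  rewrite (Rabs_pos_eq (_ ^ _)) by lra.
  generalize (bessel_bounded (tau * phi xi)
    (Rmult_le_pos _ _ Ht (phi_nonneg xi (proj2 Hx)))) (Rabs_pos (bessel (tau * phi xi))).
  nra.
Qed.

Lemma kernel_continuous n tau xi : xi < 1 -> continuous (kernel n tau) xi.
Proof.
  intros Hx. apply (ex_derive_continuous (V := R_NormedModule)).
  unfold kernel. auto_derive.
  split; [eexists; apply bessel_derive|].
  split; [eexists; now apply phi_derive | exact I].
Qed.

(** The decay of the Bessel function extends the integrand continuously by [0] to
    [xi = 1], for [n = 0] as well. *)
Lemma ex_RInt_integrand n tau : 0 < tau -> ex_RInt (integrand n tau) 0 1.
Proof.
  intros Ht.
  apply ex_RInt_ext with (fun xi => if Rlt_dec xi 1 then kernel n tau xi else 0).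
  { rewrite Rmin_left, Rmax_right by lra. intros x Hx.
    destruct (Rlt_dec x 1); [|lra]. symmetry. apply integrand_kernel; lra. }
  apply (ex_RInt_continuous (V := R_CompleteNormedModule)).
  rewrite Rmin_left, Rmax_right by lra. intros z Hz.
  destruct (Req_dec z 1) as [->|Hne].
  - apply filterlim_locally. intros eps.
    destruct (bessel_decay eps (cond_pos eps)) as [X [HX0 HX]].
    exists (mkposreal _ (exp_pos (- 1 - X / tau))). intros x Hx.
    change (Rabs (x - 1) < exp (- 1 - X / tau)) in Hx.
    assert (H1 : exp (- 1 - X / tau) < 1).
    { rewrite <- exp_0. apply exp_increasing.
      assert (0 < X / tau) by (now apply Rdiv_lt_0_compat). lra. }
    apply Rabs_def2 in Hx.
    destruct (Rlt_dec 1 1) as [h|_]; [lra|].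
    destruct (Rlt_dec x 1) as [h|h]; [|apply ball_center].
    change (Rabs (kernel n tau x - 0) < eps). rewrite Rminus_0_r.
    unfold kernel. rewrite Rabs_mult.
    generalize (pow_le_1 (1 - x) n ltac:(lra)). intros Hp.
    rewrite (Rabs_pos_eq (_ ^ _)) by lra.
    assert (HL : ln (1 - x) <= - 1 - X / tau).
    { rewrite <- (ln_exp (- 1 - X / tau)). apply ln_le; lra. }
    assert (Hph : X <= tau * phi x).
    { apply Rle_trans with (tau * (X / tau)); [right; field; lra|].
      apply Rmult_le_compat_l; [lra|]. unfold phi. lra. }
    generalize (HX _ Hph) (Rabs_pos (bessel (tau * phi x))). nra.
  - assert (Hz1 : z < 1) by lra.
    apply continuous_ext_loc with (kernel n tau); [|now apply kernel_continuous].
    assert (Hl : locally z (fun x => x < 1)) by (now apply (open_lt 1)).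
    revert Hl. apply filter_imp. intros x Hx. destruct (Rlt_dec x 1); [reflexivity | lra].
Qed.

(** * The short time scale *)

Definition kernel_dtau (n : nat) (tau xi : R) : R :=
  (1 - xi) ^ n * (phi xi * bessel1 (tau * phi xi)).

Lemma kernel_derive_tau n tau xi :
  is_derive (fun u => kernel n u xi) tau (kernel_dtau n tau xi).
Proof.
  unfold kernel, kernel_dtau. apply is_derive_scal.
  apply (is_derive_comp bessel (fun u => u * phi xi)).
  - apply bessel_derive.
  - auto_derive; [auto | ring].
Qed.

Lemma kernel_dtau_continuity_2d n tau xi : xi < 1 ->
  continuity_2d_pt (kernel_dtau n) tau xi.
Proof.
  intros Hx. unfold kernel_dtau.
  assert (Hphi : continuity_2d_pt (fun _ v => phi v) tau xi).
  { apply (continuity_1d_2d_pt_comp phi (fun _ v => v)).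
    - apply derivable_continuous_pt. exists (xi / (1 - xi)).
      apply is_derive_Reals. now apply phi_derive.
    - apply continuity_2d_pt_id2. }
  apply continuity_2d_pt_mult.
  - apply (continuity_1d_2d_pt_comp (fun v => (1 - v) ^ n) (fun _ v => v)).
    + apply derivable_continuous_pt. apply ex_derive_Reals_0. auto_derive. auto.
    + apply continuity_2d_pt_id2.
  - apply continuity_2d_pt_mult; [exact Hphi|].
    apply (continuity_1d_2d_pt_comp bessel1 (fun u v => u * phi v)).
    + apply derivable_continuous_pt. exists (bessel2 (tau * phi xi)).
      apply is_derive_Reals, bessel1_derive.
    + apply continuity_2d_pt_mult; [apply continuity_2d_pt_id1 | exact Hphi].
Qed.

Lemma kernel_dtau_continuous n tau xi : xi < 1 -> continuous (kernel_dtau n tau) xi.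
Proof.
  intros Hx. apply (ex_derive_continuous (V := R_NormedModule)).
  unfold kernel_dtau. auto_derive.
  split; [eexists; now apply phi_derive|].
  split; [eexists; apply bessel1_derive|]. split; [eexists; now apply phi_derive | exact I].
Qed.

(** As [phi] is unbounded near [xi = 1], differentiation under the integral sign
    and integration by parts are carried out for
    [0 <= xi <= 1 - d]. *)
Definition truncated (d : R) (n : nat) (tau : R) : R := RInt (kernel n tau) 0 (1 - d).

Lemma ex_RInt_kernel n tau d : 0 < d < 1 -> ex_RInt (kernel n tau) 0 (1 - d).
Proof.
  intros Hd. apply (ex_RInt_continuous (V := R_CompleteNormedModule)).
  rewrite Rmin_left, Rmax_right by lra. intros z Hz. apply kernel_continuous. lra.
Qed.

Definition truncation_defect (d : R) (n : nat) (tau : R) : R :=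
  d ^ S n * (phi (1 - d) * bessel1 (tau * phi (1 - d))) / (INR n + 1).

(** Since [phi' = xi / (1 - xi)], Bessel's equation makes
    [(n + 1) * d(kernel)/dtau] equal to [kernel (n + 1) - kernel n] up to an exact
    derivative in [xi]. *)
Lemma kernel_parts n tau xi : xi < 1 ->
  is_derive (kernel_dtau (S n) tau) xi
    (- (INR n + 1) * kernel_dtau n tau xi - (kernel n tau xi - kernel (S n) tau xi)).
Proof.
  intros Hx. assert (Hp := phi_derive xi Hx).
  assert (HK : is_derive (fun x => phi x * bessel1 (tau * phi x)) xi
                 (- (xi / (1 - xi) * bessel (tau * phi xi)))).
  { evar_last.
    { apply (is_derive_mult phi (fun x => bessel1 (tau * phi x))).
      - exact Hp.
      - apply (is_derive_comp bessel1 (fun x => tau * phi x)).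
        + apply bessel1_derive.
        + apply is_derive_scal. exact Hp.
      - intros; apply Rmult_comm. }
    change (xi / (1 - xi) * bessel1 (tau * phi xi)
      + phi xi * (tau * (xi / (1 - xi)) * bessel2 (tau * phi xi))
      = - (xi / (1 - xi) * bessel (tau * phi xi))).
    generalize (bessel_ode (tau * phi xi)). intros O.
    replace (bessel (tau * phi xi))
      with (- (tau * phi xi * bessel2 (tau * phi xi) + bessel1 (tau * phi xi))) by lra.
    ring. }
  unfold kernel_dtau at 1. evar_last.
  { apply (is_derive_mult (fun x => (1 - x) ^ S n) (fun x => phi x * bessel1 (tau * phi x)) xi
      (- (INR n + 1) * (1 - xi) ^ n)).
    - auto_derive; [auto|]. change (Nat.pred (S n)) with n.
      change (match n with 0%nat => 1 | S _ => INR n + 1 end) with (INR (S n)).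
      change (1 + - xi) with (1 - xi).
      rewrite S_INR. ring.
    - exact HK.
    - intros; apply Rmult_comm. }
  unfold kernel_dtau, kernel.
  change (- (INR n + 1) * (1 - xi) ^ n * (phi xi * bessel1 (tau * phi xi))
    + (1 - xi) ^ S n * (- (xi / (1 - xi) * bessel (tau * phi xi)))
    = - (INR n + 1) * ((1 - xi) ^ n * (phi xi * bessel1 (tau * phi xi)))
      - ((1 - xi) ^ n * bessel (tau * phi xi) - (1 - xi) ^ S n * bessel (tau * phi xi))).
  simpl pow. field. lra.
Qed.

(** On the short time scale only arrivals matter: integration by parts shows that
    the integral obeys the limiting pure birth equations, up to a boundary term at
    the truncation point. *)
Lemma truncated_derive d n tau : 0 < d < 1 ->
  is_derive (truncated d n) tau
    ((truncated d (S n) tau - truncated d n tau) / (INR n + 1)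
     - truncation_defect d n tau).
Proof.
  intros Hd.
  evar_last.
  { apply (is_derive_RInt_param (kernel n) 0 (1 - d) tau).
    - exists posreal_one. intros u _ t _. eexists. apply kernel_derive_tau.
    - rewrite Rmin_left, Rmax_right by lra. intros t Ht.
      apply continuity_2d_pt_ext with (kernel_dtau n).
      + intros u v. symmetry. apply is_derive_unique, kernel_derive_tau.
      + apply kernel_dtau_continuity_2d. lra.
    - exists posreal_one. intros u _. now apply ex_RInt_kernel. }
  rewrite (RInt_ext _ (kernel_dtau n tau)).
  2:{ intros x _. apply is_derive_unique, kernel_derive_tau. }
  assert (Hdt : ex_RInt (kernel_dtau n tau) 0 (1 - d)).
  { apply (ex_RInt_continuous (V := R_CompleteNormedModule)).
    rewrite Rmin_left, Rmax_right by lra. intros z Hz. apply kernel_dtau_continuous. lra. }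
  assert (P : is_RInt (fun x => - (INR n + 1) * kernel_dtau n tau x
                 - (kernel n tau x - kernel (S n) tau x)) 0 (1 - d)
               (kernel_dtau (S n) tau (1 - d) - kernel_dtau (S n) tau 0)).
  { apply (is_RInt_derive (V := R_CompleteNormedModule) (kernel_dtau (S n) tau));
      rewrite Rmin_left, Rmax_right by lra; intros x Hx.
    - apply kernel_parts. lra.
    - apply (continuous_minus (V := R_NormedModule)).
      + apply (continuous_scal_r (V := R_NormedModule)). apply kernel_dtau_continuous. lra.
      + apply (continuous_minus (V := R_NormedModule)); apply kernel_continuous; lra. }
  assert (Q : is_RInt (fun x => - (INR n + 1) * kernel_dtau n tau x
                 - (kernel n tau x - kernel (S n) tau x)) 0 (1 - d)
               (- (INR n + 1) * RInt (kernel_dtau n tau) 0 (1 - d)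
                - (truncated d n tau - truncated d (S n) tau))).
  { apply (is_RInt_minus (V := R_NormedModule)).
    - apply (is_RInt_scal (V := R_NormedModule)). now apply (RInt_correct (V := R_CompleteNormedModule)).
    - apply (is_RInt_minus (V := R_NormedModule));
        apply (RInt_correct (V := R_CompleteNormedModule)); now apply ex_RInt_kernel. }
  assert (E := is_RInt_unique _ _ _ _ P). rewrite (is_RInt_unique _ _ _ _ Q) in E.
  unfold kernel_dtau at 2 3 in E. rewrite phi_0 in E.
  replace (1 - (1 - d)) with d in E by ring.
  unfold truncation_defect. assert (Hn := pos_INR n).
  as_reals. apply (Rmult_eq_reg_l (INR n + 1)); [|lra].
  transitivity (truncated d (S n) tau - truncated d n tau
    - d ^ S n * (phi (1 - d) * bessel1 (tau * phi (1 - d)))).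
  - rewrite Rmult_0_l, Rmult_0_r in E. lra.
  - field. lra.
Qed.

Lemma truncated_init d n : 0 < d < 1 ->
  truncated d n 0 = (1 - d ^ S n) / (INR n + 1).
Proof.
  intros Hd. assert (Hn := pos_INR n). unfold truncated.
  rewrite (RInt_ext _ (fun x => (1 - x) ^ n)).
  2:{ intros x _. unfold kernel. rewrite Rmult_0_l, bessel_0. apply Rmult_1_r. }
  assert (P : is_RInt (fun x => (1 - x) ^ n) 0 (1 - d)
     (minus (- ((1 - (1 - d)) ^ S n / (INR n + 1))) (- ((1 - 0) ^ S n / (INR n + 1))))).
  { apply (is_RInt_derive (V := R_CompleteNormedModule) (fun x => - ((1 - x) ^ S n / (INR n + 1)))).
    - intros x _. auto_derive; [auto|]. change (Nat.pred (S n)) with n.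
      change (match n with 0%nat => 1 | S _ => INR n + 1 end) with (INR (S n)).
      change (1 + - x) with (1 - x).
      rewrite S_INR. field. lra.
    - intros x _. apply (ex_derive_continuous (V := R_NormedModule)). auto_derive. auto. }
  rewrite (is_RInt_unique _ _ _ _ P).
  replace (1 - (1 - d)) with d by ring. rewrite Rminus_0_r, pow1.
  unfold minus, plus, opp. simpl. field. lra.
Qed.

Lemma truncated_bounded d n tau : 0 < d < 1 -> 0 <= tau -> Rabs (truncated d n tau) <= 1.
Proof.
  intros Hd Ht.
  apply Rle_trans with ((1 - d - 0) * 1); [|lra].
  apply (norm_RInt_le_const (V := R_NormedModule) (kernel n tau)).
  - lra.
  - intros x Hx. apply kernel_bounded; lra.
  - apply (RInt_correct (V := R_CompleteNormedModule)). now apply ex_RInt_kernel.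
Qed.

Lemma truncation_error d n tau : 0 < d < 1 -> 0 < tau ->
  Rabs (RInt (integrand n tau) 0 1 - truncated d n tau) <= d.
Proof.
  intros Hd Ht.
  assert (H01 := ex_RInt_integrand n tau Ht).
  assert (H1 : ex_RInt (integrand n tau) 0 (1 - d)).
  { apply (ex_RInt_Chasles_1 (V := R_CompleteNormedModule)) with 1; [lra | exact H01]. }
  assert (H2 : ex_RInt (integrand n tau) (1 - d) 1).
  { apply (ex_RInt_Chasles_2 (V := R_CompleteNormedModule)) with 0; [lra | exact H01]. }
  rewrite <- (RInt_Chasles (V := R_CompleteNormedModule) _ _ _ _ H1 H2).
  assert (E : RInt (integrand n tau) 0 (1 - d) = truncated d n tau).
  { apply RInt_ext. rewrite Rmin_left, Rmax_right by lra. intros x Hx.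
    apply integrand_kernel; lra. }
  rewrite E. change plus with Rplus.
  match goal with |- Rabs (?a + ?b - ?a) <= _ =>
    assert (Eb : a + b - a = b) by (as_reals; ring); rewrite Eb end.
  apply Rle_trans with ((1 - (1 - d)) * 1); [|lra].
  apply (norm_RInt_le_const (V := R_NormedModule)
    (fun x => if Rlt_dec x 1 then integrand n tau x else 0)).
  - lra.
  - intros x Hx. destruct (Rlt_dec x 1).
    + rewrite integrand_kernel by lra. apply kernel_bounded; lra.
    + change (Rabs 0 <= 1). rewrite Rabs_R0. lra.
  - apply (is_RInt_ext (integrand n tau)).
    + rewrite Rmin_left, Rmax_right by lra. intros x Hx.
      destruct (Rlt_dec x 1); [reflexivity | lra].
    + now apply (RInt_correct (V := R_CompleteNormedModule)).
Qed.

(** The boundary term is at most [d * ln (/ d)]; writing [d = eta ^ 2] bounds this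
    by [2 * eta], through [ln x <= x - 1] at [x = / eta]. *)
Lemma truncation_defect_bound eta n tau : 0 < eta < 1 -> 0 <= tau ->
  Rabs (truncation_defect (eta ^ 2) n tau) <= 2 * eta.
Proof.
  intros He Ht. set (d := eta ^ 2).
  assert (Hd : 0 < d < 1) by (unfold d; split; simpl; nra).
  assert (Hp : 0 <= phi (1 - d)) by (apply phi_nonneg; lra).
  assert (Hb := bessel1_bounded (tau * phi (1 - d)) (Rmult_le_pos _ _ Ht Hp)).
  assert (Hdp : d * phi (1 - d) <= 2 * eta).
  { unfold phi. replace (1 - (1 - d)) with d by ring.
    assert (L : ln d = - (2 * ln (/ eta))).
    { unfold d. simpl. rewrite Rmult_1_r, ln_mult, ln_Rinv by lra. ring. }
    assert (L2 := ln_le_sub (/ eta) (Rinv_0_lt_compat _ (proj1 He))).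
    apply Rle_trans with (d * (2 * / eta)); [rewrite L; nra|].
    unfold d. right. field. lra. }
  assert (Hdn := pow_le_1 d n ltac:(lra)).
  assert (Hn := pos_INR n).
  unfold truncation_defect, Rdiv. rewrite !Rabs_mult, <- tech_pow_Rmult, Rabs_mult.
  rewrite (Rabs_pos_eq (d ^ n)), (Rabs_pos_eq d), (Rabs_pos_eq (phi _)) by lra.
  assert (Hi : 0 < / (INR n + 1) <= 1).
  { split; [apply Rinv_0_lt_compat; lra|]. rewrite <- Rinv_1. apply Rinv_le_contravar; lra. }
  rewrite (Rabs_pos_eq (/ _)) by lra.
  assert (Hdp0 : 0 <= d * phi (1 - d)) by (apply Rmult_le_pos; lra).
  replace (d * d ^ n * (phi (1 - d) * Rabs (bessel1 (tau * phi (1 - d)))) * / (INR n + 1))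
    with (d * phi (1 - d) * (d ^ n * Rabs (bessel1 (tau * phi (1 - d))) * / (INR n + 1)))
    by ring.
  assert (0 <= d ^ n * Rabs (bessel1 (tau * phi (1 - d))) <= 1).
  { generalize (Rabs_pos (bessel1 (tau * phi (1 - d)))). nra. }
  assert (0 <= d ^ n * Rabs (bessel1 (tau * phi (1 - d))) * / (INR n + 1) <= 1) by nra.
  nra.
Qed.

(** Departures have rate at most [1] and act during the time [tau / rho]; they and
    the boundary term are the only sources of error after [t = 0]. *)
Lemma density_truncated rho V n tau eta :
  0 < rho -> is_sojourn_tail rho V -> 0 < eta < 1 -> 0 <= tau ->
  Rabs (density rho V n (tau / rho) - truncated (eta ^ 2) n tau)
  <= eta ^ 2 + (2 / rho + 2 * eta) * tau.
Proof.
  intros Hr HV He Ht. set (d := eta ^ 2).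
  assert (Hd : 0 < d < 1) by (unfold d; split; simpl; nra).
  set (w := fun (_ : nat) (t : R) => d + (2 + rho * (2 * eta)) * t).
  assert (Htr : 0 <= tau / rho) by (apply Rdiv_le_0_compat; lra).
  assert (Hc : 0 <= 2 + rho * (2 * eta)) by nra.
  assert (HI : forall k t,
    is_derive (fun t => truncated d k (rho * t)) t
      (rho * ((truncated d (S k) (rho * t) - truncated d k (rho * t)) / (INR k + 1)
              - truncation_defect d k (rho * t)))).
  { intros k t. apply (is_derive_comp (truncated d k) (fun t => rho * t)).
    - now apply truncated_derive.
    - auto_derive; [auto | ring]. }
  replace (truncated d n tau) with (truncated d n (rho * (tau / rho)))
    by (f_equal; field; lra).
  replace (d + (2 / rho + 2 * eta) * tau) with (w n (tau / rho))
    by (unfold w; field; lra).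
  apply (domination 0 (1 + rho) (tau / rho) 2 _ _ _
    (fun k t => density rho V k t - truncated d k (rho * t))
    (fun k t => ps_generator rho (fun i => density rho V i t) k
      - rho * ((truncated d (S k) (rho * t) - truncated d k (rho * t)) / (INR k + 1)
               - truncation_defect d k (rho * t)))
    w (fun _ _ => 2 + rho * (2 * eta)) Htr (ps_rates rho 0 Hr)).
  - intros k t _ Hkt.
    assert (D0 := density_nonneg rho V Hr HV k t (proj1 Hkt)).
    assert (D1 := density_le_1 rho V Hr HV k t (proj1 Hkt)).
    assert (B := truncated_bounded d k (rho * t) Hd ltac:(nra)).
    apply Rabs_le_between in B. apply Rabs_le. lra.
  - intros k t _ Hkt. unfold w. nra.
  - intros t Hk. lia.
  - intros k _. assert (Hk := pos_INR k).
    rewrite Rmult_0_r, truncated_init, density_init by assumption.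
    replace (/ (INR k + 1) - (1 - d ^ S k) / (INR k + 1)) with (d ^ S k / (INR k + 1))
      by (field; lra).
    assert (Hdn := pow_le_1 d k ltac:(lra)).
    rewrite Rabs_pos_eq by (apply Rdiv_le_0_compat; [apply pow_le|]; lra).
    unfold w. rewrite Rmult_0_r, Rplus_0_r. apply Rle_div_l; [lra|]. simpl. nra.
  - intros k _. apply right_continuous0_minus.
    + now apply density_right_continuous0.
    + apply continuous_right_continuous0.
      apply (ex_derive_continuous (V := R_NormedModule)). eexists. apply HI.
  - intros k _. apply continuous_right_continuous0.
    apply (ex_derive_continuous (V := R_NormedModule)). unfold w. auto_derive. auto.
  - intros k t _ Hkt. apply (is_derive_minus (V := R_NormedModule)).
    + apply density_ode; [assumption | lra].
    + apply HI.
  - intros k t _ Hkt. unfold w. auto_derive; [auto | ring].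
  - intros k t _ Hkt. rewrite generator_minus. fold (ps_generator rho).
    assert (Hk := pos_INR k).
    assert (Bp := truncated_bounded d (Nat.pred k) (rho * t) Hd ltac:(nra)).
    assert (B0 := truncated_bounded d k (rho * t) Hd ltac:(nra)).
    assert (BE := truncation_defect_bound eta k (rho * t) He ltac:(nra)). fold d in BE.
    assert (Hdn : 0 <= INR k / (INR k + 1) <= 1).
    { split; [apply Rdiv_le_0_compat; lra | apply Rle_div_l; lra]. }
    assert (Ew : ps_generator rho (fun i => w i t) k <= 0).
    { unfold w. rewrite ps_generator_const.
      assert (0 <= (d + (2 + rho * (2 * eta)) * t) / (INR k + 1)).
      { apply Rdiv_le_0_compat; nra. } lra. }
    match goal with |- Rabs ?x <= _ =>
      replace x with (INR k / (INR k + 1) * truncated d (Nat.pred k) (rho * t)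
         - truncated d k (rho * t) + rho * truncation_defect d k (rho * t)) end.
    2:{ unfold ps_generator, generator, ps_down, ps_up, ps_total. field. lra. }
    apply Rabs_le_between in Bp, B0, BE.
    apply Rle_trans with (2 + rho * (2 * eta)); [|lra].
    apply Rabs_le. split; nra.
  - lia.
  - lra.
Qed.

Lemma density_short_time rho V n tau :
  0 < rho -> is_sojourn_tail rho V -> 0 < tau ->
  Rabs (density rho V n (tau / rho) - RInt (integrand n tau) 0 1) <= 2 * tau / rho.
Proof.
  intros Hr HV Ht. apply le_epsilon. intros eps Heps.
  set (eta := Rmin (1 / 2) (eps / (2 + 2 * tau))).
  assert (He : 0 < eta < 1).
  { assert (0 < eps / (2 + 2 * tau)) by (apply Rdiv_lt_0_compat; lra).
    unfold eta. split; [apply Rmin_glb_lt; lra|].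
    generalize (Rmin_l (1 / 2) (eps / (2 + 2 * tau))). lra. }
  assert (He2 : (2 + 2 * tau) * eta <= eps).
  { apply Rle_trans with ((2 + 2 * tau) * (eps / (2 + 2 * tau))); [|right; field; lra].
    apply Rmult_le_compat_l; [lra | apply Rmin_r]. }
  assert (A := density_truncated rho V n tau eta Hr HV He (Rlt_le _ _ Ht)).
  assert (B := truncation_error (eta ^ 2) n tau ltac:(simpl; nra) Ht).
  replace (density rho V n (tau / rho) - RInt (integrand n tau) 0 1)
    with ((density rho V n (tau / rho) - truncated (eta ^ 2) n tau)
          - (RInt (integrand n tau) 0 1 - truncated (eta ^ 2) n tau)) by ring.
  eapply Rle_trans; [apply Rabs_triang|]. rewrite Rabs_Ropp.
  replace (2 * tau / rho) with (2 / rho * tau) by (field; lra).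
  assert (eta ^ 2 <= eta) by (simpl; nra). nra.
Qed.

(** The integral is a limit of densities which [density_lower] keeps away from [0];
    its positivity is not visible on the oscillating integrand. *)
Lemma integral_pos (V : R -> nat -> R -> R) n tau :
  (forall rho, 0 < rho -> is_sojourn_tail rho (V rho)) -> 0 < tau ->
  0 < RInt (integrand n tau) 0 1.
Proof.
  intros HV Ht. assert (Hn := pos_INR n).
  apply Rlt_le_trans with (exp (- (2 * tau)) / (INR n + 1)).
  { apply Rdiv_lt_0_compat; [apply exp_pos | lra]. }
  apply le_epsilon. intros eps Heps.
  set (rho := Rmax 1 (2 * tau / eps)).
  assert (Hr1 : 1 <= rho) by apply Rmax_l.
  assert (Hr2 : 2 * tau / eps <= rho) by apply Rmax_r.
  assert (Hr : 0 < rho) by lra.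
  assert (A := density_short_time rho (V rho) n tau Hr (HV rho Hr) Ht).
  assert (B := density_lower rho (V rho) Hr (HV rho Hr) n (tau / rho)
     ltac:(apply Rdiv_le_0_compat; lra)).
  assert (C : exp (- (2 * tau)) / (INR n + 1)
     <= exp (- (ps_total rho n * (tau / rho))) / (INR n + 1)).
  { apply Rmult_le_compat_r; [left; apply Rinv_0_lt_compat; lra|].
    apply exp_le_compat. unfold ps_total.
    replace ((1 + rho / (INR n + 1)) * (tau / rho)) with (tau * / rho + tau * / (INR n + 1))
      by (field; lra).
    assert (/ rho <= 1) by (rewrite <- Rinv_1; apply Rinv_le_contravar; lra).
    assert (/ (INR n + 1) <= 1) by (rewrite <- Rinv_1; apply Rinv_le_contravar; lra).
    nra. }
  assert (D : 2 * tau / rho <= eps).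
  { apply Rle_div_l; [lra|]. apply Rle_div_l in Hr2; lra. }
  apply Rabs_le_between in A. lra.
Qed.

Lemma density_short_time_equiv (V : R -> nat -> R -> R) n tau :
  (forall rho, 0 < rho -> is_sojourn_tail rho (V rho)) -> 0 < tau ->
  is_lim (fun rho => sojourn_density (V rho) n (tau / rho)
                     / RInt (integrand n tau) 0 1) p_infty 1.
Proof.
  intros HV Ht. assert (HI := integral_pos V n tau HV Ht).
  set (J := RInt (integrand n tau) 0 1) in *.
  apply is_lim_spec. intros eps.
  exists (Rmax 1 (2 * tau / (eps * J))). intros rho Hrho.
  assert (Hr1 := Rmax_l 1 (2 * tau / (eps * J))).
  assert (Hr2 := Rmax_r 1 (2 * tau / (eps * J))).
  assert (Hr : 0 < rho) by lra.
  rewrite (sojourn_density_eq rho) by (auto; apply Rdiv_lt_0_compat; lra).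
  assert (A := density_short_time rho (V rho) n tau Hr (HV rho Hr) Ht). fold J in A.
  replace (density rho (V rho) n (tau / rho) / J - 1)
    with ((density rho (V rho) n (tau / rho) - J) / J) by (field; lra).
  rewrite Rabs_div, (Rabs_pos_eq J) by lra.
  apply Rlt_div_l; [lra|].
  eapply Rle_lt_trans; [exact A|].
  apply Rlt_div_l; [lra|].
  assert (He : 0 < eps * J) by (apply Rmult_lt_0_compat; [apply cond_pos | lra]).
  assert (H : 2 * tau / (eps * J) < rho) by lra.
  apply Rlt_div_l in H; lra.
Qed.

(** * The asymptotic expansions *)

Theorem theorem2p5 :
  forall V : R -> nat -> R -> R,
  (forall rho, 0 < rho -> is_sojourn_tail rho (V rho)) ->
  (* the implicit equation has exactly one solution below N, namely U *)
  (forall N T u, 0 < N -> 0 <= T -> (is_U N T u <-> u = U N T)) /\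
  (forall N, 0 < N -> U N 0 = 0) /\
  (* the two expressions of P0, and the case N = 1 *)
  (forall N T, 0 < N -> 0 < T -> N <> 1 ->
     P0 N T = (N - U N T - 1) / ((N - 1) * (N - U N T))) /\
  (forall T, 0 < T -> U 1 T = 0 /\ P0 1 T = exp (- T)) /\
  (forall T, 0 < T ->
     is_lim (fun N => P1_generic N T) 1
       ((2 * T - 9 / 2) * exp (- T) + 8 * exp (- (2 * T))
        - 9 / 2 * exp (- (3 * T)))) /\
  (* (1) *)
  (forall N T, 0 < N -> 0 < T ->
     exists C rho0 : R, forall (rho : R) (n : nat),
       0 < rho -> rho0 < rho -> INR n = N * rho ->
       Rabs (sojourn_density (V rho) n (T * rho)
             - (/ rho * P0 N T + / rho ^ 2 * P1 N T)) <= C * / rho ^ 3) /\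
  (* (2) *)
  (forall (n : nat) (tau : R), 0 < tau ->
     ex_RInt (integrand n tau) 0 1 /\
     is_lim (fun rho => sojourn_density (V rho) n (tau / rho)
                        / RInt (integrand n tau) 0 1) p_infty 1).
Proof.
  intros V HV. repeat match goal with |- _ /\ _ => split end.
  - intros N T u HN HT. now apply is_U_unique.
  - intros N HN. generalize (ray_time_0 N HN). unfold ray_time. lra.
  - intros N T HN HT HN1. rewrite P0_eval by lra. simpl.
    assert (Po := ray_origin_pos N T HN (Rlt_le _ _ HT)).
    assert (Eo := ray_origin_decay N T HN (Rlt_le _ _ HT)).
    fold (ray_origin N T).
    replace (ray_origin N T - 1) with ((N - 1) * decay N T) by lra. field. lra.
  - intros T HT. assert (E : U 1 T = 0).
    { generalize (ray_time_1 T (Rlt_le _ _ HT)). unfold ray_time. lra. }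
    split; [exact E|]. unfold P0. rewrite E. rewrite !Rminus_0_r, Rminus_0_l. field.
  - intros T HT. rewrite <- eval_P1_at_1 by lra. now apply P1_generic_lim.
  - intros N T HN HT. destruct (density_expansion V HV N T HN HT) as [C [rho0 H]].
    exists C, rho0. intros rho n Hr Hr0 Hn.
    rewrite (sojourn_density_eq rho) by (auto; now apply Rmult_lt_0_compat).
    specialize (H rho n Hr Hr0 Hn). unfold approx in H. rewrite Hn in H.
    replace (N * rho / rho) with N in H by (field; lra).
    replace (T * rho / rho) with T in H by (field; lra).
    rewrite P0_eval, P1_eval by lra. exact H.
  - intros n tau Ht. split; [now apply ex_RInt_integrand | now apply density_short_time_equiv].
Qed.
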